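(* Let $S$ be a semigroup with local units. (1) $S$ is Morita equivalent to a group if and only if it is completely simple. (2) $S$ is Morita equivalent to an inverse semigroup if and only if it is regular and locally inverse. (3) $S$ is Morita equivalent to a semilattice if and only if it is regular, locally a semilattice, and $S/\mathcal{J}$ is a meet semilattice under subset inclusion. (4) $S$ is Morita equivalent to an orthodox semigroup if and only if it is regular and locally orthodox. (5) $S$ is Morita equivalent to an $\mathcal{L}$-unipotent semigroup if and only if it is regular and locally $\mathcal{L}$-unipotent. (6) $S$ is Morita equivalent to an $E$-solid semigroup if and only if it is regular and locally $E$-solid. (7) $S$ is Morita equivalent to a union of groups if and only if it is regular, locally a union of groups, and $S/\mathcal{J}$ is a meet semilattice under subset inclusion.
   Context: A semigroup $S$ has local units if for each $s\in S$ there exist idempotents $e,f\in S$ with $es=s=sf$. For a right $S$-act $M$ and a left $S$-act $N$, $M\otimes N$ is the quotient of $M\times N$ by the equivalence relation generated by $(ms,n)\sim(m,sn)$. A left $S$-act $X$ is closed if the map $\mu_X\colon S\otimes X\to X$, $s\otimes x\mapsto sx$, is bijective. $S$-$\mathbf{FAct}$ is the category of closed left $S$-acts and left $S$-homomorphisms. Semigroups $S,T$ with local units are Morita equivalent if $S$-$\mathbf{FAct}$ and $T$-$\mathbf{FAct}$ are equivalent categories. $S$ has a property locally if each local submonoid $eSe$ ($e$ an idempotent of $S$) has that property. $S$ is regular if for each $s\in S$ there is $t\in S$ with $s=sts$ and $t=tst$ (such $t$ is an inverse of $s$); it is inverse if each element has a unique inverse. Standard semigroup terminology: a completely simple semigroup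 is a simple semigroup with a primitive idempotent; a semilattice is a commutative semigroup of idempotents; an orthodox semigroup is a regular semigroup whose idempotents form a subsemigroup; an $\mathcal{L}$-unipotent semigroup is a (regular) semigroup in which every $\mathcal{L}$-class contains exactly one idempotent; an $E$-solid semigroup is a regular semigroup such that whenever $e,f,g$ are idempotents with $e\,\mathcal{L}\,f\,\mathcal{R}\,g$ there is an idempotent $h$ with $e\,\mathcal{R}\,h\,\mathcal{L}\,g$; a union of groups is a semigroup that is the union of its subgroups. $\mathcal{L},\mathcal{R},\mathcal{J}$ are Green's relations, and $S/\mathcal{J}$ is the set of $\mathcal{J}$-classes, identified with the poset of principal two-sided ideals of $S$ ordered by inclusion. *)

(* Defs.v *)
From HB Require Import structures.
From Stdlib Require Import Relation_Operators.
From mathcomp Require Import all_boot.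
From mathcomp Require Import boolp classical_sets.

Set Implicit Arguments.
Unset Strict Implicit.
Unset Printing Implicit Defensive.

Local Open Scope classical_set_scope.
Local Open Scope group_scope.
Local Open Scope quotient_scope.

Record category := Category {
  obj :> Type;
  hom : obj -> obj -> Type;
  idm : forall X, hom X X;
  compm : forall X Y Z, hom Y Z -> hom X Y -> hom X Z;
  comp1m : forall X Y (f : hom X Y), compm (idm Y) f = f;
  compm1 : forall X Y (f : hom X Y), compm f (idm X) = f;
  compA : forall W X Y Z (h : hom Y Z) (g : hom X Y) (f : hom W X),
    compm h (compm g f) = compm (compm h g) f }.
Arguments idm {c} X.

Definition is_iso (C : category) (X Y : C) (f : hom X Y) : Prop :=
  exists g : hom Y X, compm g f = idm X /\ compm f g = idm Y.

Record functor (C D : category) := Functor {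
  fobj :> C -> D;
  fmap : forall X Y, hom X Y -> hom (fobj X) (fobj Y);
  fmap1 : forall X, fmap (idm X) = idm (fobj X);
  fmapM : forall X Y Z (g : hom Y Z) (f : hom X Y),
    fmap (compm g f) = compm (fmap g) (fmap f) }.
Arguments fmap {C D} _ {X Y} _.

Definition id_functor (C : category) : functor C C :=
  @Functor C C (fun X => X) (fun X Y f => f)
    (fun=> erefl) (fun _ _ _ _ _ => erefl).

Section CompFunctor.
Variables (C D E : category) (G : functor D E) (F : functor C D).

Lemma comp_fmap1 (X : C) : fmap G (fmap F (idm X)) = idm (G (F X)).
Proof. by rewrite !fmap1. Qed.

Lemma comp_fmapM (X Y Z : C) (g : hom Y Z) (f : hom X Y) :
  fmap G (fmap F (compm g f)) = compm (fmap G (fmap F g)) (fmap G (fmap F f)).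
Proof. by rewrite !fmapM. Qed.

Definition comp_functor : functor C E :=
  @Functor C E (fun X => G (F X)) (fun X Y f => fmap G (fmap F f))
    comp_fmap1 comp_fmapM.

End CompFunctor.

Definition naturally_isomorphic (C D : category) (F G : functor C D) : Prop :=
  exists eta : forall X, hom (F X) (G X),
    (forall X, is_iso (eta X)) /\
    (forall X Y (f : hom X Y),
       compm (eta Y) (fmap F f) = compm (fmap G f) (eta X)).

Definition equivalent_categories (C D : category) : Prop :=
  exists (F : functor C D) (G : functor D C),
    naturally_isomorphic (comp_functor G F) (id_functor C) /\
    naturally_isomorphic (comp_functor F G) (id_functor D).

Record lact (S : semigroupType) := LAct {
  lact_sort :> choiceType;
  lop : S -> lact_sort -> lact_sort;
  lopA : forall s t x, lop (s * t) x = lop s (lop t x) }.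

Record ract (S : semigroupType) := RAct {
  ract_sort :> choiceType;
  rop : ract_sort -> S -> ract_sort;
  ropA : forall x s t, rop x (s * t) = rop (rop x s) t }.

Definition self_ract (S : semigroupType) : ract S :=
  @RAct S S (fun x s => x * s) (fun x s t => mulgA x s t).

Section Tensor.
Variables (S : semigroupType) (M : ract S) (N : lact S).

Definition tensor_step (p q : M * N) : Prop :=
  exists m s n, p = (rop m s, n) /\ q = (m, lop s n).

Definition tensor_rel : rel (M * N) :=
  fun p q => `[< clos_refl_sym_trans _ tensor_step p q >].

Lemma tensor_rel_refl : reflexive tensor_rel.
Proof. by move=> p; apply/asboolP; exact: rst_refl. Qed.

Lemma tensor_rel_sym : symmetric tensor_rel.
Proof. by move=> p q; apply/asboolP/asboolP; exact: rst_sym. Qed.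

Lemma tensor_rel_trans : transitive tensor_rel.
Proof.
move=> q p r /asboolP pq /asboolP qr; apply/asboolP.
exact: rst_trans pq qr.
Qed.

Canonical tensor_equiv :=
  EquivRel tensor_rel tensor_rel_refl tensor_rel_sym tensor_rel_trans.

Definition tensor := {eq_quot tensor_rel}.

Definition tens (m : M) (n : N) : tensor := \pi_tensor (m, n).

End Tensor.

Section Mu.
Variables (S : semigroupType) (X : lact S).

(* [repr] picks a representative; [mu_tens] shows that the choice is harmless. *)
Definition mu (z : tensor (self_ract S) X) : X :=
  let p := repr z in lop p.1 p.2.

Lemma mu_tens (s : S) (x : X) : mu (tens (M := self_ract S) s x) = lop s x.
Proof.
rewrite /mu /tens; set p := repr _.
have /eqmodP/asboolP : p = (s, x) %[mod tensor (self_ract S) X].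
  by rewrite reprK.
suff H q r : clos_refl_sym_trans _ (@tensor_step S (self_ract S) X) q r ->
    lop (q.1 : S) q.2 = lop (r.1 : S) r.2 by move/H.
elim=> {q r} [q r [m [t [y [-> ->]]]]|//|//|q r u _ -> _ -> //] /=.
exact: lopA.
Qed.

Definition closed_lact : Prop := bijective mu.

End Mu.

Record lact_hom (S : semigroupType) (X Y : lact S) := LActHom {
  lact_fun :> X -> Y;
  lact_funM : forall s x, lact_fun (lop s x) = lop s (lact_fun x) }.

Lemma lact_hom_ext (S : semigroupType) (X Y : lact S) (f g : lact_hom X Y) :
  f =1 g -> f = g.
Proof.
case: f g => f fM [g gM] /= /funext fg; case: _ / fg in gM *.
by congr LActHom; exact: Prop_irrelevance.
Qed.

Definition lact_id (S : semigroupType) (X : lact S) : lact_hom X X :=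
  @LActHom S X X id (fun _ _ => erefl).

Lemma lact_comp_subproof (S : semigroupType) (X Y Z : lact S)
  (g : lact_hom Y Z) (f : lact_hom X Y) s x :
  g (f (lop s x)) = lop s (g (f x)).
Proof. by rewrite !lact_funM. Qed.

Definition lact_comp (S : semigroupType) (X Y Z : lact S)
    (g : lact_hom Y Z) (f : lact_hom X Y) : lact_hom X Z :=
  LActHom (lact_comp_subproof g f).

Record fact (S : semigroupType) := FActObj {
  fact_lact :> lact S;
  fact_closed : closed_lact fact_lact }.

Definition FAct (S : semigroupType) : category :=
  @Category (fact S) (fun X Y => lact_hom X Y)
    (fun X => lact_id X) (fun X Y Z g f => lact_comp g f)
    (fun X Y f => @lact_hom_ext S X Y (lact_comp (lact_id Y) f) f (fun=> erefl))
    (fun X Y f => @lact_hom_ext S X Y (lact_comp f (lact_id X)) f (fun=> erefl))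
    (fun W X Y Z h g f =>
       @lact_hom_ext S W Z (lact_comp h (lact_comp g f))
         (lact_comp (lact_comp h g) f) (fun=> erefl)).

Definition is_idem (S : semigroupType) (e : S) : Prop := e * e = e.

Definition has_local_units (S : semigroupType) : Prop :=
  forall s : S, exists e f : S, [/\ is_idem e, is_idem f, e * s = s & s * f = s].

Definition morita_equivalent (S T : semigroupType) : Prop :=
  [/\ has_local_units S, has_local_units T
    & equivalent_categories (FAct S) (FAct T)].

Definition is_inverse_of (S : semigroupType) (s t : S) : Prop :=
  s = s * t * s /\ t = t * s * t.

Definition regular (S : semigroupType) : Prop :=
  forall s : S, exists t, is_inverse_of s t.

Definition inverse_semigroup (S : semigroupType) : Prop :=
  forall s : S, exists! t, is_inverse_of s t.

Definition semilattice (S : semigroupType) : Prop :=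
  (forall x y : S, x * y = y * x) /\ (forall x : S, is_idem x).

Definition orthodox (S : semigroupType) : Prop :=
  regular S /\ (forall e f : S, is_idem e -> is_idem f -> is_idem (e * f)).

(* Principal ideals are those of S with an identity adjoined: the sets
   S^1 a, a S^1 and S^1 a S^1. *)
Definition left_ideal (S : semigroupType) (a : S) : set S :=
  [set x | x = a \/ exists s, x = s * a].

Definition right_ideal (S : semigroupType) (a : S) : set S :=
  [set x | x = a \/ exists s, x = a * s].

Definition two_sided_ideal (S : semigroupType) (a : S) : set S :=
  [set x | [\/ x = a, exists s, x = s * a, exists t, x = a * t
             | exists s t, x = s * a * t]].

Definition greenL (S : semigroupType) (a b : S) : Prop :=
  left_ideal a = left_ideal b.

Definition greenR (S : semigroupType) (a b : S) : Prop :=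
  right_ideal a = right_ideal b.

Definition L_unipotent (S : semigroupType) : Prop :=
  regular S /\ (forall a : S, exists! e, is_idem e /\ greenL a e).

Definition E_solid (S : semigroupType) : Prop :=
  regular S /\
  (forall e f g : S, is_idem e -> is_idem f -> is_idem g ->
     greenL e f -> greenR f g ->
     exists h, [/\ is_idem h, greenR e h & greenL h g]).

Definition subgroup_of (S : semigroupType) (H : set S) : Prop :=
  exists e, [/\ H e,
    forall x y, H x -> H y -> H (x * y),
    forall x, H x -> e * x = x /\ x * e = x
    & forall x, H x -> exists y, [/\ H y, x * y = e & y * x = e]].

Definition union_of_groups (S : semigroupType) : Prop :=
  \bigcup_(H in [set H : set S | subgroup_of H]) H = [set: S].

Definition is_ideal (S : semigroupType) (I : set S) : Prop :=
  I !=set0 /\ (forall s x, I x -> I (s * x) /\ I (x * s)).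

Definition simple_semigroup (S : semigroupType) : Prop :=
  forall I : set S, is_ideal I -> I = [set: S].

(* Minimality is among all idempotents: there is no zero to exclude, since a
   simple semigroup with a zero is trivial (hence completely simple). *)
Definition primitive_idem (S : semigroupType) (e : S) : Prop :=
  is_idem e /\ (forall f : S, is_idem f -> f = e * f -> f = f * e -> f = e).

Definition completely_simple (S : semigroupType) : Prop :=
  simple_semigroup S /\ exists e : S, primitive_idem e.

(* The quotient S/J, each J-class being identified with the principal two-sided
   ideal that its elements generate. *)
Definition J_classes (S : semigroupType) : set (set S) :=
  range (@two_sided_ideal S).

Definition meet_semilattice_under_inclusion (T : Type) (P : set (set T)) :
    Prop :=
  forall A B, P A -> P B ->
    exists C, [/\ P C, C `<=` A, C `<=` B
      & forall D, P D -> D `<=` A -> D `<=` B -> D `<=` C].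

Section LocalSubmonoid.
Variables (S : semigroupType) (e : S).

Definition local_set : set S := [set e * s * e | s in [set: S]].

Lemma local_set_mul_closed : mulg_closed (mem local_set).
Proof.
move=> x y; rewrite !inE => -[a _ <-] [b _ <-].
by exists (a * e * e * b); rewrite // !mulgA.
Qed.

Definition local_submonoid : Type := set_type local_set.

HB.instance Definition _ := SubChoice.on local_submonoid.
HB.instance Definition _ :=
  SubChoice_isSubSemigroup.Build S (mem local_set) local_submonoid
    local_set_mul_closed.

End LocalSubmonoid.

Definition locally_has (P : semigroupType -> Prop) (S : semigroupType) : Prop :=
  forall e : S, is_idem e -> P (local_submonoid e).

(* Main.v *)
From HB Require Import structures.
From Stdlib Require Import Relation_Operators.
From mathcomp Require Import all_boot.
From mathcomp Require Import boolp classical_sets.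
Require Import Defs.

Set Implicit Arguments.
Unset Strict Implicit.
Unset Printing Implicit Defensive.

Local Open Scope group_scope.
Local Open Scope quotient_scope.

(** A semigroup [S] with local units has a Karoubi envelope: its objects are the
    idempotents of [S], and its morphisms from [e] to [f] are the elements of
    [e S f]. A closed act [X] amounts to the presheaf [e |-> e X] on it, so that
    an equivalence of Karoubi envelopes is a Morita equivalence
    ([morita_of_Karoubi]). Conversely the acts [S e] can be recognised inside the
    category of closed acts, as the objects into which every jointly epic family
    contains a split epimorphism, and so a Morita equivalence induces an
    equivalence of Karoubi envelopes ([Karoubi_of_morita]). The theorem is thus
    a statement about Karoubi envelopes.

    From left to right: regularity, the isomorphism types of the local submonoids
    [e S e] and the order of principal ideals can be read off the Karoubi
    envelope, and each of the properties passes from [T] to its local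
    submonoids. In a union of groups the ideal of [x y] is the meet of the ideals
    of [x] and of [y].

    From right to left, for a regular [S]: a matrix [p] with [p_(e, f)] in [e S f]
    and [p_(e, e) = e] turns the triples [(e, x, f)], with [x] in [e S f], into
    a semigroup, with the product [(e, x, f) (g, y, h) = (e, x p_(f, g) y, h)].
    This consolidation has the same Karoubi envelope as [S], up to equivalence;
    so does its quotient by the largest congruence that is injective on each local
    submonoid. The freedom lies in [p].

    - To obtain properties of idempotents, fix an idempotent [z] and let
      [p_(e, f) = q_e r_f] for distinct [e] and [f], where [q_e] is in [e S z] and
      [r_e] is an inverse of it in [z S e]. Then a product of idempotents of the
      consolidation can be transported to [z S z], where the local hypothesis
      applies. The consolidation is orthodox, or E-solid, if [S] is so locally;
      its quotient is L-unipotent, or inverse, if [S] is so locally.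
    - For unions of groups, take [p_(e, f)] in the J-class that is the meet of
      those of [e] and [f]. Then [x p x] is J-related to [x], which forces [x] into
      a subgroup. If moreover [S] is locally a semilattice, then the consolidation
      is a normal band, and its quotient is a semilattice.
    - A completely simple [S] is equivalent to [e S e], for [e] a primitive
      idempotent, because this is a group and all idempotents are isomorphic. *)

(** * Equivalences of categories *)

Definition faithful (C D : category) (F : functor C D) : Prop :=
  forall (X Y : C) (f g : hom X Y), fmap F f = fmap F g -> f = g.

Definition full (C D : category) (F : functor C D) : Prop :=
  forall (X Y : C) (u : hom (F X) (F Y)), exists f, fmap F f = u.

Definition isomorphic (C : category) (X Y : C) : Prop :=
  exists f : hom X Y, is_iso f.

Definition essentially_surjective (C D : category) (F : functor C D) : Prop :=
  forall Y : D, exists X : C, isomorphic (F X) Y.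

Definition weak_equivalence (C D : category) (F : functor C D) : Prop :=
  [/\ faithful F, full F & essentially_surjective F].

Lemma fmap_is_iso (C D : category) (F : functor C D) (X Y : C) (f : hom X Y) :
  is_iso f -> is_iso (fmap F f).
Proof. by move=> [g [gf fg]]; exists (fmap F g); rewrite -!fmapM gf fg !fmap1. Qed.

Lemma isomorphic_fobj (C D : category) (F : functor C D) (X Y : C) :
  isomorphic X Y -> isomorphic (F X) (F Y).
Proof. by move=> [f fi]; exists (fmap F f); exact: fmap_is_iso. Qed.

Lemma isomorphic_sym (C : category) (X Y : C) :
  isomorphic X Y -> isomorphic Y X.
Proof. by move=> [f [g [gf fg]]]; exists g, f. Qed.

Lemma isomorphic_trans (C : category) (Y X Z : C) :
  isomorphic X Y -> isomorphic Y Z -> isomorphic X Z.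
Proof.
move=> [f [f' [ff ff']]] [g [g' [gg gg']]]; exists (compm g f), (compm f' g').
split; rewrite compA.
  by rewrite -(compA f') gg compm1.
by rewrite -(compA g) ff' compm1.
Qed.

Lemma is_iso_mono (C : category) (X Y Z : C) (f : hom Y Z) (g h : hom X Y) :
  is_iso f -> compm f g = compm f h -> g = h.
Proof. by move=> [f' [ff _]] /(congr1 (compm f')); rewrite !compA ff !comp1m. Qed.

Lemma is_iso_epi (C : category) (X Y Z : C) (f : hom X Y) (g h : hom Y Z) :
  is_iso f -> compm g f = compm h f -> g = h.
Proof.
move=> [f' [_ ff]] /(congr1 (fun u => compm u f')).
by rewrite -!compA ff !compm1.
Qed.

Lemma equivalent_categories_sym (C D : category) :
  equivalent_categories C D -> equivalent_categories D C.
Proof. by move=> [F [G [GF FG]]]; exists G, F. Qed.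

Lemma faithful_of_naturally_isomorphic (C D : category) (F : functor C D)
    (G : functor D C) :
  naturally_isomorphic (comp_functor G F) (id_functor C) -> faithful F.
Proof.
move=> [eta [etai nat]] X Y f g fg; apply: (is_iso_epi (etai X)).
by rewrite -[compm f _](nat X Y f) -[compm g _](nat X Y g) /= fg.
Qed.

Lemma weak_equivalence_of_equivalence (C D : category) (F : functor C D)
    (G : functor D C) :
  naturally_isomorphic (comp_functor G F) (id_functor C) ->
  naturally_isomorphic (comp_functor F G) (id_functor D) ->
  weak_equivalence F.
Proof.
move=> GF FG; have faithF := faithful_of_naturally_isomorphic GF.
have faithG := faithful_of_naturally_isomorphic FG.
split=> //; last first.
  by case: FG => [eps [epsi _]] Y; exists (G Y), (eps Y); exact: epsi.
move: GF => [eta [etai nat]] X Y u; have [e' [e'e ee']] := etai X.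
exists (compm (compm (eta Y) (fmap G u)) e'); apply: faithG.
apply: (is_iso_mono (etai Y)); have /= -> := nat X Y.
by rewrite -!compA e'e compm1.
Qed.

(** Objects and morphisms of the inverse functor are picked by choice, the
    morphisms being transported along the picked isomorphisms. *)
Lemma equivalent_of_weak_equivalence (C D : category) (F : functor C D) :
  weak_equivalence F -> equivalent_categories C D.
Proof.
move=> [faithF fullF essF].
have fullc X Y (u : hom (F X) (F Y)) : {f | fmap F f = u} by exact/cid/fullF.
have essc Y : {X : C & {i : hom (F X) Y &
    {j | compm j i = idm _ /\ compm i j = idm _}}}.
  have [X /cid[i /cid[j ij]]] := cid (essF Y); by exists X, i, j.
pose g Y := projT1 (essc Y); pose i Y : hom (F (g Y)) Y := projT1 (projT2 (essc Y)).
pose j Y : hom Y (F (g Y)) := sval (projT2 (projT2 (essc Y))).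
have ji Y : compm (j Y) (i Y) = idm _ := proj1 (svalP (projT2 (projT2 (essc Y)))).
have ij Y : compm (i Y) (j Y) = idm _ := proj2 (svalP (projT2 (projT2 (essc Y)))).
pose gm X Y (f : hom X Y) : hom (g X) (g Y) :=
  sval (fullc _ _ (compm (compm (j Y) f) (i X))).
have gmE X Y (f : hom X Y) : fmap F (gm X Y f) = compm (compm (j Y) f) (i X).
  exact: svalP (fullc _ _ _).
have gm1 X : gm X X (idm X) = idm (g X).
  by apply: faithF; rewrite gmE compm1 ji fmap1.
have gmM X Y Z (u : hom Y Z) (v : hom X Y) :
    gm X Z (compm u v) = compm (gm Y Z u) (gm X Y v).
  apply: faithF; rewrite fmapM !gmE -!compA; congr compm; congr compm.
  by rewrite compA ij comp1m.
pose G := Functor gm1 gmM; exists F, G; split.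
  have eta_ X : {e : hom (g (F X)) X | fmap F e = i (F X)} by exact: fullc.
  exists (fun X => sval (eta_ X)); split=> [X|X Y f] /=.
    have [e' e'E] := fullF _ _ (j (F X)); exists e'.
    split; apply: faithF; rewrite fmapM fmap1 e'E (svalP (eta_ X)).
      exact: ji.
    exact: ij.
  apply: faithF; rewrite !fmapM /= (svalP (eta_ X)) (svalP (eta_ Y)) gmE.
  by rewrite !compA ij comp1m.
exists i; split=> [X|X Y f] /=; first by exists (j X); split.
by rewrite gmE !compA ij comp1m.
Qed.

Lemma isomorphic_reflect (C D : category) (F : functor C D) (X Y : C) :
  weak_equivalence F -> isomorphic (F X) (F Y) -> isomorphic X Y.
Proof.
move=> [faF fuF _] [u [v [vu uv]]].
have [f fE] := fuF _ _ u; have [g gE] := fuF _ _ v.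
by exists f, g; split; apply: faF; rewrite fmapM fmap1 fE gE.
Qed.

Lemma weak_equivalence_comp (C D E : category) (G : functor D E)
    (F : functor C D) :
  weak_equivalence F -> weak_equivalence G ->
  weak_equivalence (comp_functor G F).
Proof.
move=> [faF fuF esF] [faG fuG esG]; split.
- by move=> X Y f g /= /faG /faF.
- by move=> X Y u; have [v <-] := fuG _ _ u; have [f <-] := fuF _ _ v; exists f.
- move=> Z; have [Y YZ] := esG Z; have [X XY] := esF Y; exists X => /=.
  apply: isomorphic_trans YZ; exact: isomorphic_fobj.
Qed.

Lemma equivalent_categories_trans (D C E : category) :
  equivalent_categories C D -> equivalent_categories D E ->
  equivalent_categories C E.
Proof.
move=> [F [F' [FF FF']]] [G [G' [GG GG']]].
apply: (@equivalent_of_weak_equivalence _ _ (comp_functor G F)).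
apply: weak_equivalence_comp; last exact: weak_equivalence_of_equivalence GG GG'.
exact: weak_equivalence_of_equivalence FF FF'.
Qed.

(** The values of [F] on morphisms are transported along chosen isomorphisms to
    values of [J], and then lifted through [J]. *)
Lemma lift_along_fully_faithful (A B D : category) (F : functor A D)
    (J : functor B D) :
  faithful F -> full F -> faithful J -> full J ->
  (forall a, exists b, isomorphic (F a) (J b)) ->
  (forall b, exists a, isomorphic (F a) (J b)) ->
  exists K : functor A B, weak_equivalence K.
Proof.
move=> faF fuF faJ fuJ ess ess'.
have fullc X Y (u : hom (J X) (J Y)) : {f | fmap J f = u} by exact/cid/fuJ.
have essc a : {b : B & {i : hom (F a) (J b) &
    {j | compm j i = idm _ /\ compm i j = idm _}}}.
  have [X /cid[i /cid[j ij]]] := cid (ess a); by exists X, i, j.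
pose k a := projT1 (essc a); pose i a : hom (F a) (J (k a)) := projT1 (projT2 (essc a)).
pose j a : hom (J (k a)) (F a) := sval (projT2 (projT2 (essc a))).
have ji a : compm (j a) (i a) = idm _ := proj1 (svalP (projT2 (projT2 (essc a)))).
have ij a : compm (i a) (j a) = idm _ := proj2 (svalP (projT2 (projT2 (essc a)))).
pose km X Y (f : hom X Y) : hom (k X) (k Y) :=
  sval (fullc _ _ (compm (compm (i Y) (fmap F f)) (j X))).
have kmE X Y (f : hom X Y) :
  fmap J (km X Y f) = compm (compm (i Y) (fmap F f)) (j X) := svalP (fullc _ _ _).
have km1 X : km X X (idm X) = idm (k X).
  by apply: faJ; rewrite kmE !fmap1 compm1 ij.
have kmM X Y Z (u : hom Y Z) (v : hom X Y) :
    km X Z (compm u v) = compm (km Y Z u) (km X Y v).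
  apply: faJ; rewrite fmapM !kmE fmapM -!compA; congr compm; congr compm.
  by rewrite compA ji comp1m.
exists (Functor km1 kmM); split=> [X Y f g /= /(congr1 (fmap J))|X Y u|b] /=.
- rewrite !kmE => fg; apply: faF; apply: (is_iso_mono (f := i Y)).
    by exists (j Y); split.
  by apply: (is_iso_epi (f := j X)) => //; exists (i X); split.
- have [f fE] := fuF _ _ (compm (compm (j Y) (fmap J u)) (i X)); exists f.
  apply: faJ; rewrite kmE fE !compA ij comp1m -compA ij compm1 //.
- have [a ab] := ess' b; exists a.
  have [f [g [gf fg]]] : isomorphic (J (k a)) (J b).
    by apply: isomorphic_trans ab; exists (j a), (i a).
  have [f' f'E] := fuJ _ _ f; have [g' g'E] := fuJ _ _ g.
  by exists f', g'; split; apply: faJ; rewrite fmapM fmap1 f'E g'E.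
Qed.

(** * Closed acts *)

Notation tensor_conv X :=
  (clos_refl_sym_trans _ (@tensor_step _ (self_ract _) X)).

Lemma tensor_conv_step (S : semigroupType) (X : lact S) (s t : S) (x : X) :
  tensor_conv X (s * t, x) (s, lop t x).
Proof. by apply: rst_step; exists s, t, x. Qed.

Lemma closed_lactP (S : semigroupType) (X : lact S) :
  closed_lact X <->
  (forall x : X, exists s y, x = lop s y) /\
  (forall (s t : S) (x y : X), lop s x = lop t y -> tensor_conv X (s, x) (t, y)).
Proof.
split=> [[g muK gK]|[surj inj]].
  split=> [x|s t x y st].
    by exists (repr (g x)).1, (repr (g x)).2; rewrite -[LHS]gK.
  have: tens (M := self_ract S) s x = tens (M := self_ract S) t y.
    by apply: (can_inj muK); rewrite !mu_tens.
  by move=> /eqmodP/asboolP.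
have mu_inj : injective (@mu S X).
  move=> u v; rewrite -[u]reprK -[v]reprK.
  case: (repr u) (repr v) => [s x] [t y].
  rewrite -/(tens (M := self_ract S) s x) -/(tens (M := self_ract S) t y).
  by rewrite !mu_tens => /inj st; apply/eqmodP/asboolP.
have mu_surj (x : X) : exists u, mu u = x.
  by have [s [y ->]] := surj x; exists (tens (M := self_ract S) s y); rewrite mu_tens.
exists (fun x => sval (cid (mu_surj x))) => x; last exact: (svalP (cid (mu_surj x))).
by apply: mu_inj; exact: (svalP (cid (mu_surj (mu x)))).
Qed.

Lemma closed_lact_conv (S : semigroupType) (X : fact S) (s t : S) (x y : X) :
  lop s x = lop t y -> tensor_conv X (s, x) (t, y).
Proof. by have /closed_lactP[_] := fact_closed X; apply. Qed.

Lemma closed_lact_unit (S : semigroupType) (hS : has_local_units S) (X : fact S)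
    (x : X) : exists2 e : S, is_idem e & lop e x = x.
Proof.
have /closed_lactP[/(_ x)[s [y ->]] _] := fact_closed X.
by have [e [f [ei _ es _]]] := hS s; exists e => //; rewrite -lopA es.
Qed.

(** A closed act is its own tensor product with [S]; so a function of [s x] may
    be defined through the pair [(s, x)] as soon as it is balanced. *)
Lemma closed_lact_balanced (S : semigroupType) (X : fact S) (A : Type)
    (g : S -> X -> A) :
  (forall s t x, g (s * t) x = g s (lop t x)) ->
  forall s t x y, lop s x = lop t y -> g s x = g t y.
Proof.
move=> gM s t x y /closed_lact_conv.
suff H p q : tensor_conv X p q -> g p.1 p.2 = g q.1 q.2 by move=> /H.
by elim=> [u v [m [r [n [-> ->]]]]|//|//|u v w _ -> _ ->] //=; exact: gM.
Qed.

(** * The Karoubi envelope of a semigroup *)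

Section Karoubi.
Variable S : semigroupType.

Definition idem : Type := {e : S | e * e == e}.

Definition corner (e f : idem) : Type :=
  {s : S | (val e * s == s) && (s * val f == s)}.

Lemma idemE (e : idem) : val e * val e = val e.
Proof. exact/eqP/(valP e). Qed.

Lemma corner_l (e f : idem) (s : corner e f) : val e * val s = val s.
Proof. by have /andP[/eqP] := valP s. Qed.

Lemma corner_r (e f : idem) (s : corner e f) : val s * val f = val s.
Proof. by have /andP[_ /eqP] := valP s. Qed.

Lemma mkCorner_subproof (e f : idem) (s : S) :
  val e * s = s -> s * val f = s -> (val e * s == s) && (s * val f == s).
Proof. by move=> -> ->; rewrite eqxx. Qed.

Definition mkIdem (e : S) (ei : is_idem e) : idem := exist _ e (introT eqP ei).

Definition mkCorner (e f : idem) (s : S) (es : val e * s = s)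
    (sf : s * val f = s) : corner e f :=
  exist _ s (mkCorner_subproof es sf).

Definition corner_id (e : idem) : corner e e := mkCorner (idemE e) (idemE e).

Lemma corner_comp_l (e f g : idem) (t : corner f g) (s : corner e f) :
  val e * (val s * val t) = val s * val t.
Proof. by rewrite mulgA corner_l. Qed.

Lemma corner_comp_r (e f g : idem) (t : corner f g) (s : corner e f) :
  (val s * val t) * val g = val s * val t.
Proof. by rewrite -mulgA corner_r. Qed.

Definition corner_comp (e f g : idem) (t : corner f g) (s : corner e f) :
    corner e g :=
  mkCorner (corner_comp_l t s) (corner_comp_r t s).

Lemma corner_comp1m (e f : idem) (s : corner e f) :
  corner_comp (corner_id f) s = s.
Proof. by apply: val_inj; exact: corner_r. Qed.

Lemma corner_compm1 (e f : idem) (s : corner e f) :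
  corner_comp s (corner_id e) = s.
Proof. by apply: val_inj; exact: corner_l. Qed.

Lemma corner_compA (e f g h : idem) (u : corner g h) (t : corner f g)
    (s : corner e f) :
  corner_comp u (corner_comp t s) = corner_comp (corner_comp u t) s.
Proof. by apply: val_inj; rewrite /= mulgA. Qed.

(** Composition is written diagrammatically by the product of [S]: a morphism
    from [e] to [f] is an element of [e S f], so that right multiplication by it
    maps [S e] to [S f]. *)
Definition Karoubi : category :=
  Category corner_comp1m corner_compm1 corner_compA.

End Karoubi.

Lemma fmap_val_comp (S : semigroupType) (C : category)
    (K : functor C (Karoubi S)) (X Y Z : C) (g : hom Y Z) (f : hom X Y) :
  val (fmap K (compm g f)) = val (fmap K f) * val (fmap K g).
Proof. by rewrite fmapM. Qed.

Lemma isomorphic_KaroubiP (S : semigroupType) (e f : Karoubi S) :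
  isomorphic e f <-> exists s t : S,
    [/\ val e * s = s, s * val f = s, s * t = val e & t * s = val f].
Proof.
split=> [[s [t [/(congr1 val) /= st /(congr1 val) /= ts]]]|[s [t [es sf st ts]]]].
  by exists (val s), (val t); rewrite corner_l corner_r.
have es' : val e * (val e * s) = val e * s by rewrite mulgA idemE.
have t1 : val f * (val f * t * val e) = val f * t * val e.
  by rewrite !mulgA idemE.
have t2 : (val f * t * val e) * val e = val f * t * val e.
  by rewrite -mulgA idemE.
exists (mkCorner es sf : @hom (Karoubi S) e f), (mkCorner t1 t2); split.
  by apply: val_inj; rewrite /= !mulgA sf st idemE.
by apply: val_inj; rewrite /= -!mulgA es ts idemE.
Qed.

(** * Closed acts as presheaves on the Karoubi envelope *)

Section Presheaves.
Variable C : category.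

Record presheaf := Presheaf {
  psh_at :> C -> choiceType;
  psh_act : forall X Y : C, hom X Y -> psh_at Y -> psh_at X;
  psh_act1 : forall X (x : psh_at X), psh_act (idm X) x = x;
  psh_actM : forall X Y Z (g : hom Y Z) (f : hom X Y) x,
    psh_act (compm g f) x = psh_act f (psh_act g x) }.

Record psh_hom (A B : presheaf) := PshHom {
  psh_fun :> forall X : C, A X -> B X;
  psh_nat : forall (X Y : C) (f : hom X Y) (x : A Y),
    psh_fun (psh_act f x) = psh_act f (psh_fun x) }.

Lemma psh_hom_ext (A B : presheaf) (f g : psh_hom A B) :
  (forall X x, f X x = g X x) -> f = g.
Proof.
case: f g => f fN [g gN] /= fg.
have {}fg : f = g by apply: functional_extensionality_dep => X; apply/funext/fg.
by case: _ / fg in gN *; congr PshHom; exact: Prop_irrelevance.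
Qed.

Definition psh_id (A : presheaf) : psh_hom A A :=
  @PshHom A A (fun X x => x) (fun _ _ _ _ => erefl).

Lemma psh_comp_subproof (A B D : presheaf) (g : psh_hom B D) (f : psh_hom A B)
    (X Y : C) (u : hom X Y) (x : A Y) :
  g X (f X (psh_act u x)) = psh_act u (g Y (f Y x)).
Proof. by rewrite !psh_nat. Qed.

Definition psh_comp (A B D : presheaf) (g : psh_hom B D) (f : psh_hom A B) :
    psh_hom A D :=
  @PshHom A D (fun X x => g X (f X x)) (@psh_comp_subproof A B D g f).

Definition PSh : category :=
  @Category presheaf psh_hom psh_id psh_comp
    (fun A B f => @psh_hom_ext A B (psh_comp (psh_id B) f) f (fun _ _ => erefl))
    (fun A B f => @psh_hom_ext A B (psh_comp f (psh_id A)) f (fun _ _ => erefl))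
    (fun A B D E h g f => @psh_hom_ext A E (psh_comp h (psh_comp g f))
       (psh_comp (psh_comp h g) f) (fun _ _ => erefl)).

End Presheaves.

Section Restriction.
Variables (S : semigroupType) (C : category) (K : functor C (Karoubi S)).

Section Object.
Variable X : lact S.

Definition res_at (c : C) : choiceType := {x : X | lop (val (K c)) x == x}.

Lemma res_atE (c : C) (x : res_at c) : lop (val (K c)) (val x) = val x.
Proof. exact/eqP/(valP x). Qed.

Definition mkRes (c : C) (x : X) (cx : lop (val (K c)) x = x) : res_at c :=
  exist _ x (introT eqP cx).

Lemma res_act_subproof (c d : C) (f : hom c d) (x : res_at d) :
  lop (val (K c)) (lop (val (fmap K f)) (val x)) = lop (val (fmap K f)) (val x).
Proof. by rewrite -lopA corner_l. Qed.

Definition res_act (c d : C) (f : hom c d) (x : res_at d) : res_at c :=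
  mkRes (res_act_subproof f x).

Lemma res_act1 (c : C) (x : res_at c) : res_act (idm c) x = x.
Proof. by apply: val_inj; rewrite /= fmap1 res_atE. Qed.

Lemma res_actM (c d e : C) (g : hom d e) (f : hom c d) (x : res_at e) :
  res_act (compm g f) x = res_act f (res_act g x).
Proof. by apply: val_inj; rewrite /= fmap_val_comp lopA. Qed.

Definition res_obj : presheaf C := Presheaf res_act1 res_actM.

End Object.

Section Morphism.
Variables (X Y : lact S) (f : lact_hom X Y).

Lemma res_hom_subproof (c : C) (x : res_at X c) :
  lop (val (K c)) (f (val x)) = f (val x).
Proof. by rewrite -lact_funM res_atE. Qed.

Definition res_fun (c : C) (x : res_obj X c) : res_obj Y c :=
  mkRes (res_hom_subproof x).

Lemma res_nat (c d : C) (u : hom c d) (x : res_obj X d) :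
  res_fun (psh_act u x) = psh_act u (res_fun x).
Proof. by apply: val_inj; rewrite /= lact_funM. Qed.

Definition res_hom : psh_hom (res_obj X) (res_obj Y) := PshHom res_nat.

End Morphism.

Lemma res_fmap1 (X : FAct S) : res_hom (idm X) = idm (res_obj X : PSh C).
Proof. by apply: psh_hom_ext => c x; apply: val_inj. Qed.

Lemma res_fmapM (X Y Z : FAct S) (g : hom Y Z) (f : hom X Y) :
  res_hom (compm g f) = @compm (PSh C) _ _ _ (res_hom g) (res_hom f).
Proof. by apply: psh_hom_ext => c x; apply: val_inj. Qed.

Definition res : functor (FAct S) (PSh C) :=
  @Functor (FAct S) (PSh C) (fun X => res_obj X) (fun X Y f => res_hom f)
    res_fmap1 res_fmapM.

Hypotheses (hS : has_local_units S) (hK : weak_equivalence K).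

(** By essential surjectivity, the parts [K c X] of an act [X] determine the part
    [e X] for every idempotent [e]. *)
Lemma idem_split (e : S) : is_idem e -> exists c (u v : S),
  [/\ e = u * v, u * val (K c) = u & val (K c) * v = v].
Proof.
move=> ei; have [_ _ /(_ (mkIdem ei))[c /isomorphic_sym]] := hK.
move=> /isomorphic_KaroubiP[s [t [_ sk st ts]]]; exists c, s, (t * s * t).
rewrite !mulgA; split=> //; first by rewrite st -mulgA st; exact/esym.
by rewrite -(mulgA _ t s) ts idemE.
Qed.

Lemma K_fullP (c d : C) (s : S) :
  val (K c) * s = s -> s * val (K d) = s -> {f : hom c d | val (fmap K f) = s}.
Proof.
move=> cs sd; have [_ fu _] := hK.
by have [f fE] := cid (fu c d (mkCorner cs sd)); exists f; rewrite fE.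
Qed.

Lemma fact_split (X : fact S) (x : X) : exists c (u v : S),
  [/\ lop (u * v) x = x, u * val (K c) = u & val (K c) * v = v].
Proof.
have [e ei ex] := closed_lact_unit hS x.
by have [c [u [v [uv uc cv]]]] := idem_split ei; exists c, u, v; rewrite -uv.
Qed.

Lemma res_faithful : faithful res.
Proof.
move=> X Y f g fg; apply: lact_hom_ext => x.
have [c [u [v [uvx uc cv]]]] := fact_split x.
have vx : lop (val (K c)) (lop v x) = lop v x by rewrite -lopA cv.
have := congr1 (fun h : psh_hom (res_obj X) (res_obj Y) => val (h c (mkRes vx))) fg.
by move=> /= e; rewrite -uvx lopA (lact_funM f u) (lact_funM g u) e.
Qed.

(** A natural transformation [alpha] extends to [x |-> u alpha (v x)], where
    [u v x = x]. Closedness of the act makes this equivariant: the function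
    [(s, x) |-> s u alpha (v x)] is balanced. *)
Lemma res_full : full res.
Proof.
move=> X Y alpha.
pose split_ (x : X) := cid (fact_split x).
pose c x := sval (split_ x).
pose u x := sval (cid (svalP (split_ x))).
pose v x := sval (cid (svalP (cid (svalP (split_ x))))).
have uvP x : [/\ lop (u x * v x) x = x, u x * val (K (c x)) = u x
    & val (K (c x)) * v x = v x].
  exact: svalP (cid (svalP (cid (svalP (split_ x))))).
have wP x : lop (val (K (c x))) (lop (v x) x) = lop (v x) x.
  by have [_ _ cv] := uvP x; rewrite -lopA cv.
pose w x : res_obj X (c x) := mkRes (wP x).
have key (x : X) d (b : S) (z : res_obj X d) :
    val (K d) * b = b -> val z = lop b x ->
    val (alpha d z) = lop (b * u x) (val (alpha (c x) (w x))).
  move=> db zE; have [uvx uc cv] := uvP x.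
  have dbu : val (K d) * (b * u x) = b * u x by rewrite mulgA db.
  have buc : b * u x * val (K (c x)) = b * u x by rewrite -mulgA uc.
  have [f fE] := K_fullP dbu buc.
  have -> : z = psh_act f (w x).
    by apply: val_inj; rewrite /= fE zE -lopA -mulgA lopA uvx.
  by rewrite psh_nat /= fE.
pose h (x : X) : Y := lop (u x) (val (alpha (c x) (w x))).
have bal (s t : S) (x y : X) : lop s x = lop t y -> lop s (h x) = lop t (h y).
  apply: (closed_lact_balanced (g := fun s x => lop s (h x))).
  move=> {s t x y} s t x; rewrite /h -!lopA.
  have [_ [f [_ fi _ sf]]] := hS s; have [d [a [b [fE ad db]]]] := idem_split fi.
  have dz : lop (val (K d)) (lop (b * t) x) = lop (b * t) x.
    by rewrite -lopA mulgA db.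
  have /= e1 := key x d (b * t) (mkRes dz) _ erefl.
  have /= e2 := key (lop t x) d b (mkRes dz) db (lopA _ _ _).
  have {e1} e1 := e1 (etrans (mulgA _ _ _) (congr1 (fun r => r * t) db)).
  have sab : s * a * b = s by rewrite -mulgA -fE.
  by rewrite -{1}sab -{2}sab -!mulgA 2!lopA mulgA -e1 e2 -!lopA !mulgA.
have hM s x : h (lop s x) = lop s (h x).
  have [uvsx _ _] := uvP (lop s x).
  have := bal (u (lop s x) * v (lop s x)) s (lop s x) x uvsx.
  move=> <-; rewrite lopA /h; congr lop.
  have [_ _ cv] := uvP (lop s x).
  by rewrite -lopA -(key _ _ _ (w (lop s x))).
exists (LActHom hM); apply: psh_hom_ext => d z; apply: val_inj => /=.
have [uvz uc cv] := uvP (val z).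
have cz : lop (u (val z) * v (val z)) (val z) = lop (val (K d)) (val z).
  by rewrite uvz res_atE.
have := bal _ _ _ _ cz; rewrite {2}/h -lopA -(key _ _ _ z) ?res_atE ?idemE // => <-.
by rewrite lopA /h -[lop (v _) _]lopA -(key _ _ _ (w (val z))).
Qed.

End Restriction.

Section Quotient.
Variables (A : choiceType) (r : A -> A -> Prop).

Notation conv := (clos_refl_sym_trans A r).

Definition conv_rel : rel A := fun p q => `[< conv p q >].

Lemma conv_rel_refl : reflexive conv_rel.
Proof. by move=> p; apply/asboolP; exact: rst_refl. Qed.

Lemma conv_rel_sym : symmetric conv_rel.
Proof. by move=> p q; apply/asboolP/asboolP; exact: rst_sym. Qed.

Lemma conv_rel_trans : transitive conv_rel.
Proof.
by move=> q p s /asboolP pq /asboolP qs; apply/asboolP; exact: rst_trans pq qs.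
Qed.

Canonical conv_equiv :=
  EquivRel conv_rel conv_rel_refl conv_rel_sym conv_rel_trans.

Definition quot := {eq_quot conv_rel}.

HB.instance Definition _ := Choice.on quot.

Definition cls (x : A) : quot := \pi_quot x.

Lemma clsP (x y : A) : cls x = cls y <-> conv x y.
Proof.
split=> [/eqmodP/asboolP //|xy].
by apply/eqmodP/asboolP.
Qed.

Lemma cls_step (x y : A) : r x y -> cls x = cls y.
Proof. by move=> xy; apply/clsP; exact: rst_step. Qed.

Lemma cls_repr (z : quot) : cls (repr z) = z.
Proof. exact: reprK. Qed.

Lemma cls_surj (z : quot) : exists x, z = cls x.
Proof. by exists (repr z); rewrite cls_repr. Qed.

Lemma repr_lift (B : Type) (g : A -> B) (x : A) :
  (forall x y, r x y -> g x = g y) -> g (repr (cls x)) = g x.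
Proof.
move=> gr; suff H p q : conv p q -> g p = g q by apply/H/clsP/cls_repr.
by elim=> [? ? /gr //|//|? ? _ -> //|? ? ? _ -> _ ->].
Qed.

End Quotient.
Arguments cls {A} r x.
Arguments repr_lift {A} r {B} g x.

Section Extension.
Variables (S0 S : semigroupType) (K : functor (Karoubi S0) (Karoubi S)).
Notation C := (Karoubi S0).
Hypotheses (hS : has_local_units S) (hK : weak_equivalence K).
Variable A : presheaf C.

(** The act attached to [A] is the tensor product over [C] of [S] with [A]: the
    triple [(s, c, x)] stands for [s x], where [x] is in the part of the act
    that the idempotent [K c] is to fix. *)
Definition ext_raw : choiceType :=
  {classic {c : idem S0 & (S * A c)%type}}.

Definition ext_mk (s : S) (c : C) (x : A c) : ext_raw :=
  existT (fun c : idem S0 => (S * A c)%type) c (s, x).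

Definition ext_step (p q : ext_raw) : Prop :=
  exists (c d : C) (f : hom c d) (s : S) (x : A d),
    p = ext_mk (s * val (fmap K f)) x /\ q = ext_mk s (psh_act f x).

Notation ext_cls := (cls ext_step).

Lemma ext_clsM (c d : C) (f : hom c d) (s : S) (x : A d) :
  ext_cls (ext_mk (s * val (fmap K f)) x) = ext_cls (ext_mk s (psh_act f x)).
Proof. by apply: cls_step; exists c, d, f, s, x. Qed.

Lemma ext_cls_id (c : C) (s : S) (x : A c) :
  ext_cls (ext_mk (s * val (K c)) x) = ext_cls (ext_mk s x).
Proof. by have := ext_clsM (idm c) s x; rewrite fmap1 psh_act1. Qed.

Definition ext_mul (s : S) (p : ext_raw) : ext_raw :=
  ext_mk (s * (projT2 p).1) (projT2 p).2.

Definition ext_op (s : S) (z : quot ext_step) : quot ext_step :=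
  ext_cls (ext_mul s (repr z)).

Lemma ext_opE (s t : S) (c : C) (x : A c) :
  ext_op s (ext_cls (ext_mk t x)) = ext_cls (ext_mk (s * t) x).
Proof.
rewrite /ext_op (repr_lift ext_step (fun p => ext_cls (ext_mul s p))) //.
move=> p q [c' [d [f [r [y [-> ->]]]]]].
by rewrite /ext_mul /= mulgA ext_clsM.
Qed.

Lemma ext_surj (z : quot ext_step) : exists c s (x : A c), z = ext_cls (ext_mk s x).
Proof. by have [[c [s x]] ->] := cls_surj z; exists c, s, x. Qed.

Lemma ext_opA (s t : S) (z : quot ext_step) :
  ext_op (s * t) z = ext_op s (ext_op t z).
Proof. by have [c [r [x ->]]] := ext_surj z; rewrite !ext_opE mulgA. Qed.

Definition ext_lact : lact S := LAct ext_opA.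

Lemma ext_closed : closed_lact ext_lact.
Proof.
apply/closed_lactP; split=> [z|s t z w].
  have [c [s [x ->]]] := ext_surj z; have [e [f [_ _ es _]]] := hS s.
  by exists e, (ext_cls (ext_mk s x)); rewrite /= ext_opE es.
have [c [s' [x ->]]] := ext_surj z; have [d [t' [y ->]]] := ext_surj w.
have conv_mk (a : S) c' (x' : A c') b : tensor_conv ext_lact
    (a, ext_cls (ext_mk b x')) (a * b, ext_cls (ext_mk (val (K c')) x')).
  have -> : ext_cls (ext_mk b x') =
      lop (l := ext_lact) b (ext_cls (ext_mk (val (K c')) x')).
    by rewrite /= ext_opE ext_cls_id.
  by apply: rst_sym; exact: (@tensor_conv_step _ ext_lact).
rewrite /= !ext_opE => /clsP E.
apply: rst_trans (conv_mk _ _ _ _) _.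
apply: rst_trans (rst_sym _ _ _ _ (conv_mk _ _ _ _)).
suff H (p q : ext_raw) : clos_refl_sym_trans _ ext_step p q -> tensor_conv ext_lact
    ((projT2 p).1, ext_cls (ext_mk (val (K (projT1 p))) (projT2 p).2))
    ((projT2 q).1, ext_cls (ext_mk (val (K (projT1 q))) (projT2 q).2)).
  exact: H E.
elim=> [p' q' [c' [d' [f [r [u [-> ->]]]]]]|p'|p' q' _|p' q' r' _ pq _].
- apply: rst_trans (@tensor_conv_step _ ext_lact _ _ _) _.
  by rewrite /= ext_opE corner_r -ext_clsM corner_l; exact: rst_refl.
- exact: rst_refl.
- exact: rst_sym.
- exact: rst_trans.
Qed.

Definition ext_fact : fact S := FActObj ext_closed.

(** This inverts the map that sends [x] in [A c] to the class of [(K c, c, x)]: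
    if [K c] fixes [s x], then [s x = (K c s) x], where [K c s] cut down to [K d]
    on the right is a morphism of [C]. *)
Lemma ext_component (c : C) :
  {g : ext_lact -> A c | forall d (f : hom c d) (s : S) (x : A d),
     val (K c) * s * val (K d) = val (fmap K f) ->
     g (ext_cls (ext_mk s x)) = psh_act f x}.
Proof.
have [faK fuK _] := hK.
have full_ d (s : S) : {f : hom c d | val (fmap K f) = val (K c) * s * val (K d)}.
  apply: K_fullP => //; first by rewrite !mulgA idemE.
  by rewrite -mulgA idemE.
pose g0 (p : ext_raw) : A c :=
  psh_act (sval (full_ (projT1 p) (projT2 p).1)) (projT2 p).2.
exists (fun z => g0 (repr z)) => d f s x fE; rewrite repr_lift.
  rewrite /g0 /=; congr psh_act; apply: faK; apply: val_inj.
  by rewrite -fE; exact: svalP (full_ _ _).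
move=> p q [c' [d' [h [r [y [-> ->]]]]]]; rewrite /g0 /= -psh_actM.
congr psh_act; apply: faK; apply: val_inj; rewrite fmap_val_comp.
rewrite (svalP (full_ _ _)) (svalP (full_ _ _)) /=.
by rewrite -!mulgA corner_r corner_l.
Qed.

Lemma res_ext_isomorphic : isomorphic (res K ext_fact : PSh C) (A : PSh C).
Proof.
pose g c := sval (ext_component c).
have gE c d (f : hom c d) (s : S) (x : A d) :
    val (K c) * s * val (K d) = val (fmap K f) ->
    g c (ext_cls (ext_mk s x)) = psh_act f x.
  exact: (svalP (ext_component c) d f s x).
have g1 c (x : A c) : g c (ext_cls (ext_mk (val (K c)) x)) = x.
  by rewrite (gE _ _ (idm c)) ?psh_act1 // fmap1 !idemE.
have g2 c (z : res_obj K ext_lact c) :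
    ext_cls (ext_mk (val (K c)) (g c (val z))) = val z.
  have zE := res_atE z; have [d [s [x zs]]] := ext_surj (val z).
  have [||h hE] := @K_fullP _ _ K hK c d (val (K c) * s * val (K d)).
  - by rewrite !mulgA idemE.
  - by rewrite -mulgA idemE.
  rewrite -[RHS]zE /= zs (gE _ _ h) ?hE // ext_opE -ext_clsM hE.
  by rewrite !mulgA idemE ext_cls_id.
have cP c (x : A c) : lop (l := ext_lact) (val (K c)) (ext_cls (ext_mk (val (K c)) x))
    = ext_cls (ext_mk (val (K c)) x).
  by rewrite /= ext_opE idemE.
have nat1 (c d : C) (f : hom c d) (x : res_obj K ext_lact d) :
    g c (val (psh_act f x)) = psh_act f (g d (val x)).
  by rewrite /= -[in LHS]g2 ext_opE corner_r (gE _ _ f) ?corner_l ?corner_r.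
have nat2 (c d : C) (f : hom c d) (x : A d) :
    (mkRes (cP c (psh_act f x)) : res_obj K ext_lact c) =
    psh_act f (mkRes (cP d x) : res_obj K ext_lact d).
  by apply: val_inj; rewrite /= ext_opE corner_r -ext_clsM corner_l.
exists (@PshHom C (res_obj K ext_lact) A (fun c z => g c (val z)) nat1 :
          hom (res K ext_fact : PSh C) (A : PSh C)).
exists (@PshHom C A (res_obj K ext_lact) (fun c x => mkRes (cP c x)) nat2).
split; apply: psh_hom_ext => c x /=; last exact: g1.
by apply: val_inj => /=; exact: g2.
Qed.

End Extension.

(** Both categories of closed acts are the category of presheaves on [Karoubi S],
    by restriction along the identity for [S], and along [K] for [T]. *)
Theorem morita_of_Karoubi (S T : semigroupType)
    (K : functor (Karoubi S) (Karoubi T)) :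
  has_local_units S -> has_local_units T -> weak_equivalence K ->
  morita_equivalent S T.
Proof.
move=> hS hT hK; split=> //.
have presheaves S0 S1 (L : functor (Karoubi S0) (Karoubi S1)) :
    has_local_units S1 -> weak_equivalence L ->
    equivalent_categories (FAct S1) (PSh (Karoubi S0)).
  move=> hS1 hL; apply: (@equivalent_of_weak_equivalence _ _ (res L)).
  split; [exact: res_faithful | exact: res_full | move=> A].
  exists (ext_fact L hS1 A); exact: res_ext_isomorphic.
have idK : weak_equivalence (id_functor (Karoubi S)).
  split=> [X Y f g //|X Y u|X]; first by exists u.
  by exists X, (idm X), (idm X); rewrite comp1m.
apply: equivalent_categories_trans (presheaves _ _ _ hS idK) _.
exact: equivalent_categories_sym (presheaves _ _ _ hT hK).
Qed.

(** * Recovering the Karoubi envelope from the category of closed acts *)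

Section Principal.
Variable S : semigroupType.

Definition principal_sort (e : idem S) : choiceType := {x : S | x * val e == x}.

Definition mkPrincipal (e : idem S) (x : S) (xe : x * val e = x) :
  principal_sort e := exist _ x (introT eqP xe).

Lemma principalE (e : idem S) (x : principal_sort e) : val x * val e = val x.
Proof. exact/eqP/(valP x). Qed.

Lemma principal_op_subproof (e : idem S) (s : S) (x : principal_sort e) :
  s * val x * val e = s * val x.
Proof. by rewrite -mulgA principalE. Qed.

Definition principal_op (e : idem S) (s : S) (x : principal_sort e) :
  principal_sort e := mkPrincipal (principal_op_subproof s x).

Lemma principal_opA (e : idem S) (s t : S) (x : principal_sort e) :
  principal_op (s * t) x = principal_op s (principal_op t x).
Proof. by apply: val_inj; rewrite /= mulgA. Qed.

Definition principal_lact (e : idem S) : lact S := LAct (@principal_opA e).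

Definition principal_gen (e : idem S) : principal_lact e :=
  mkPrincipal (idemE e).

Lemma principal_genE (e : idem S) (x : principal_lact e) :
  lop (val x) (principal_gen e) = x.
Proof. by apply: val_inj; rewrite /= principalE. Qed.

Lemma principal_closed (e : idem S) : closed_lact (principal_lact e).
Proof.
apply/closed_lactP; split=> [x|s t x y st].
  by exists (val x), (principal_gen e); rewrite principal_genE.
rewrite -(principal_genE x) -(principal_genE y).
apply: rst_trans (rst_sym _ _ _ _ (tensor_conv_step _ _ _)) _.
apply: rst_trans _ (tensor_conv_step _ _ _).
by have := congr1 val st => /= ->; exact: rst_refl.
Qed.

Definition principal_obj (e : idem S) : fact S := FActObj (@principal_closed e).

Lemma principal_fmap_subproof (e f : idem S) (s : corner e f)
  (x : principal_sort e) : val x * val s * val f = val x * val s.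
Proof. by rewrite -mulgA corner_r. Qed.

Definition principal_fun (e f : idem S) (s : corner e f)
  (x : principal_lact e) : principal_lact f :=
  mkPrincipal (principal_fmap_subproof s x).

Lemma principal_funM (e f : idem S) (s : corner e f) (t : S)
  (x : principal_lact e) :
  principal_fun s (lop t x) = lop t (principal_fun s x).
Proof. by apply: val_inj; rewrite /= mulgA. Qed.

Definition principal_hom (e f : idem S) (s : corner e f) :
  lact_hom (principal_lact e) (principal_lact f) := LActHom (principal_funM s).

Lemma principal_fmap1 (e : Karoubi S) :
  principal_hom (idm e) = @idm (FAct S) (principal_obj e).
Proof. by apply: lact_hom_ext => x; apply: val_inj; rewrite /= principalE. Qed.

Lemma principal_fmapM (e f g : Karoubi S) (t : hom f g) (s : hom e f) :
  principal_hom (compm t s) =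
  @compm (FAct S) (principal_obj e) (principal_obj f) (principal_obj g)
    (principal_hom t) (principal_hom s).
Proof. by apply: lact_hom_ext => x; apply: val_inj; rewrite /= mulgA. Qed.

(** The Yoneda embedding, [e] being sent to [S e]. *)
Definition principal : functor (Karoubi S) (FAct S) :=
  @Functor (Karoubi S) (FAct S) principal_obj
    (fun e f s => principal_hom s) principal_fmap1 principal_fmapM.

Lemma principal_faithful : faithful principal.
Proof.
move=> e f s t st; apply: val_inj.
have := congr1 (fun u : lact_hom (principal_lact e) (principal_lact f) =>
  val (u (principal_gen e))) st.
by rewrite /= !corner_l.
Qed.

Lemma principal_full : full principal.
Proof.
move=> e f u; pose x : principal_lact f := lact_fun u (principal_gen e).
have ex : val e * val x = val x.
  have <- : lop (val e) x = x :> principal_lact f.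
    by rewrite -lact_funM; congr (lact_fun u); exact: (principal_genE (principal_gen e)).
  by rewrite /= mulgA idemE.
exists (mkCorner ex (principalE x)); apply: lact_hom_ext => z; apply: val_inj.
rewrite -[in RHS](principal_genE z).
by rewrite -[RHS]/(val (lact_fun u (lop (val z) (principal_gen e)))) lact_funM.
Qed.

End Principal.

Section Atomic.
Variable C : category.

Definition jointly_epic (X : C) (P : forall Y : C, hom Y X -> Prop) : Prop :=
  forall (W : C) (g h : hom X W),
    (forall Y f, P Y f -> compm g f = compm h f) -> g = h.

Definition split_epi (Y X : C) (f : hom Y X) : Prop :=
  exists s, compm f s = idm X.

(** The closed acts with this property are, up to isomorphism, the [S e], with
    [e] idempotent; being stated in the language of categories, it is invariant
    under equivalence. *)
Definition atomic (X : C) : Prop :=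
  forall P : forall Y : C, hom Y X -> Prop,
    jointly_epic P -> exists Y (f : hom Y X), P Y f /\ split_epi f.

End Atomic.

Lemma weak_equivalence_atomic (C D : category) (F : functor C D) (X : C) :
  weak_equivalence F -> atomic X -> atomic (F X).
Proof.
move=> [faF fuF esF] atX P epiP.
pose Q (Y' : C) (f' : hom Y' X) := exists (Y : D) (i : hom (F Y') Y) (f : hom Y (F X)),
  [/\ is_iso i, P Y f & fmap F f' = compm f i].
have /atX : jointly_epic Q.
  move=> W g h gh; apply: faF; apply: epiP => Y f Pf.
  have [Y' [i ii]] := esF Y; have [f' f'E] := fuF _ _ (compm f i).
  apply: (is_iso_epi ii); rewrite -!compA -f'E -!fmapM; congr fmap; apply: gh.
  by exists Y, i, f.
move=> [Y' [f' [[Y [i [f [_ Pf f'E]]]] [s f's]]]]; exists Y, f; split=> //.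
by exists (compm i (fmap F s)); rewrite compA -f'E -fmapM f's fmap1.
Qed.

Section JointlyEpic.
Variables (S : semigroupType) (hS : has_local_units S).
Variables (X : FAct S) (P : forall Y : FAct S, hom Y X -> Prop).

Definition hit (x : X : fact S) : Prop :=
  exists (Y : fact S) (f : lact_hom Y X) (y : Y), P f /\ f y = x.

Lemma hitM (s : S) (x : X : fact S) : hit x -> hit (lop s x).
Proof.
move=> [Y [f [y [Pf <-]]]]; exists Y, f, (lop s y); split=> //.
by rewrite lact_funM.
Qed.

(** The pushout of two copies of [X], glued along the elements that are hit. *)
Definition double_step (p q : (X : fact S) * bool) : Prop :=
  exists x, [/\ hit x, p = (x, true) & q = (x, false)].

Notation dcls x b := (cls double_step (x, b)).

Lemma double_clsP (x y : X : fact S) b c :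
  dcls x b = dcls y c <-> x = y /\ (b = c \/ hit x).
Proof.
split=> [/clsP|[-> [->//|hx]]]; last first.
  have ft : dcls y true = dcls y false by apply: cls_step; exists y.
  by case: b; case: c; rewrite ?ft.
suff H p q : clos_refl_sym_trans _ double_step p q ->
    p.1 = q.1 /\ (p.2 = q.2 \/ hit p.1) by move=> /H.
elim=> {x y b c p q}
  [p q [x [hx -> ->]]|p|p q _ [-> [->|h]]|p q r _ [-> pq] _ [qr1 qr]] /=.
- by split; [|right].
- by split; [|left].
- by split; [|left].
- by split; [|right].
- split=> //; case: pq => [->|h]; last by right.
  by case: qr => [->|h]; [left|right].
Qed.

Definition double_op (s : S) (z : quot double_step) : quot double_step :=
  dcls (lop s (repr z).1) (repr z).2.

Lemma double_opE (s : S) (x : X : fact S) b :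
  double_op s (dcls x b) = dcls (lop s x) b.
Proof.
rewrite /double_op (repr_lift double_step (fun p => dcls (lop s p.1) p.2)) //.
by move=> p q [y [hy -> ->]]; apply/double_clsP; split=> //; right; exact: hitM.
Qed.

Lemma double_surj (z : quot double_step) : exists x b, z = dcls x b.
Proof. by have [[x b] ->] := cls_surj z; exists x, b. Qed.

Lemma double_opA (s t : S) (z : quot double_step) :
  double_op (s * t) z = double_op s (double_op t z).
Proof. by have [x [b ->]] := double_surj z; rewrite !double_opE lopA. Qed.

Definition double_lact : lact S := LAct double_opA.

(** If [s x] in one copy equals [t y] in the other, it is the image of some [z]
    in an act of the family; the tensors [s x] and [t y] are both equal to
    [e z], with [e] a local unit of [z], and this tensor is common to the two
    copies. *)
Lemma double_closed : closed_lact double_lact.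
Proof.
apply/closed_lactP; split=> [z|s t z w].
  have [x [b ->]] := double_surj z; have [e ei ex] := closed_lact_unit hS x.
  by exists e, (dcls x b); rewrite /= double_opE ex.
have [x [b ->]] := double_surj z; have [y [c ->]] := double_surj w.
rewrite /= !double_opE => /double_clsP[st bc].
have inj_conv b' p q : tensor_conv X p q ->
    tensor_conv double_lact (p.1, dcls p.2 b') (q.1, dcls q.2 b').
  elim=> {p q} [p q [m [r [n [-> ->]]]]|p|p q _|p q r _ pq _].
  - by rewrite /= -double_opE; exact: (@tensor_conv_step _ double_lact).
  - exact: rst_refl.
  - exact: rst_sym.
  - exact: rst_trans.
have /closed_lact_conv xy := st.
case: bc => [->|[Y [f [v [Pf fv]]]]]; first exact: (inj_conv c _ _ xy).
have [e ei ev] := closed_lact_unit hS v.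
have /closed_lact_conv xv : lop s x = lop e (f v) by rewrite -lact_funM ev fv.
have /closed_lact_conv yv : lop e (f v) = lop t y by rewrite -lact_funM ev fv.
apply: rst_trans (inj_conv b _ _ xv) _; apply: rst_trans _ (inj_conv c _ _ yv).
rewrite /=; have -> : dcls (f v) b = dcls (f v) c.
  by apply/double_clsP; split=> //; right; exists Y, f, v.
exact: rst_refl.
Qed.

Definition double_in (b : bool) : lact_hom X double_lact :=
  @LActHom S X double_lact (fun x => dcls x b)
    (fun s x => esym (double_opE s x b)).

(** The two inclusions of [X] into the pushout agree on the family, so they are
    equal; but they only agree on the elements that are hit. *)
Lemma jointly_epic_surjective : jointly_epic P -> forall x : X : fact S, hit x.
Proof.
move=> epiP x; have tf : double_in true = double_in false.
  apply: (epiP (FActObj double_closed : FAct S) (double_in true) (double_in false)).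
  move=> Y f Pf; apply: lact_hom_ext => y /=; apply/double_clsP; split=> //.
  by right; exists Y, f, y.
have /double_clsP[_ []//] : dcls x true = dcls x false.
exact: (congr1 (fun u : lact_hom X double_lact => u x) tf).
Qed.

End JointlyEpic.

Section AtomicActs.
Variables (S : semigroupType) (hS : has_local_units S).

Definition orbit_hom (X : lact S) (e : idem S) (x : X) :
    lact_hom (principal_lact e) X :=
  @LActHom S (principal_lact e) X (fun z => lop (val z) x)
    (fun s z => lopA s (val z) x).

Lemma principal_atomic (e : Karoubi S) : atomic (principal S e).
Proof.
move=> P epiP.
have [Y [f [y [Pf fy]]]] :=
  @jointly_epic_surjective S hS (principal S e) P epiP (principal_gen e).
exists Y, f; split=> //; exists (orbit_hom e y); apply: lact_hom_ext => x /=.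
by rewrite lact_funM fy principal_genE.
Qed.

(** The maps [S e -> X] are jointly surjective, so that an atomic [X] is a
    retract of some [S e]; the idempotent endomorphism of [S e] that this
    defines is the right multiplication by some idempotent [k], and then [X] is
    isomorphic to [S k]. *)
Lemma atomic_principal (X : FAct S) :
  atomic X -> exists e, isomorphic X (principal S e).
Proof.
pose P (Y : FAct S) (f : hom Y X) := exists (e : Karoubi S)
  (i : hom (principal S e) Y) (j : hom Y (principal S e)), compm i j = idm Y.
have epiP : jointly_epic P.
  move=> W g h gh; apply: lact_hom_ext => x.
  have [e ei ex] := closed_lact_unit hS x.
  have := gh (principal S (mkIdem ei)) (orbit_hom (mkIdem ei) x).
  have Pe : P _ (orbit_hom (mkIdem ei) x : hom (principal S (mkIdem ei)) X).
    by exists (mkIdem ei), (idm _), (idm _); exact: comp1m.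
  move=> /(_ Pe).
  move=> /(congr1 (fun u : lact_hom _ _ => u (principal_gen (mkIdem ei)))) /=.
  by rewrite ex.
move=> /(_ P epiP)[Y [f [[e [i [j ij]]] [s0 fs]]]].
pose r : lact_hom (principal_lact e) X := compm f i.
pose s : lact_hom X (principal_lact e) := compm j s0.
have rs x : r (s x) = x.
  have : compm (compm f i) (compm j s0) = idm X.
    by rewrite -compA (compA i) ij comp1m fs.
  exact: (congr1 (fun u : lact_hom X X => u x)).
pose g := principal_gen e; pose k := val (s (r g)).
have sk x : val (s x) * k = val (s x).
  by rewrite -[LHS]/(val (lop (val (s x)) (s (r g)))) -!lact_funM principal_genE rs.
pose k' : idem S := mkIdem (sk (r g)).
have sM t x : mkPrincipal (e := k') (sk (lop t x)) =
    lop (l := principal_lact k') t (mkPrincipal (e := k') (sk x)).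
  by apply: val_inj; exact: (congr1 val (lact_funM s t x)).
exists k'.
exists (@LActHom S X (principal_lact k') (fun x => mkPrincipal (e := k') (sk x)) sM
   : @hom (FAct S) X (principal S k')).
have rg x : lop (val (s x)) (r g) = x by rewrite -lact_funM principal_genE rs.
exists (orbit_hom k' (r g)); split; apply: lact_hom_ext => z; first exact: rg.
apply: val_inj.
exact: etrans (congr1 val (lact_funM s (val z) (r g))) (principalE z).
Qed.

End AtomicActs.

(** An equivalence preserves atomic objects, so it carries the acts [S e] to the
    acts [T f], up to isomorphism. *)
Theorem Karoubi_of_morita (S T : semigroupType) :
  morita_equivalent S T ->
  exists K : functor (Karoubi S) (Karoubi T), weak_equivalence K.
Proof.
move=> [hS hT [F [G [GF FG]]]].
have wF := weak_equivalence_of_equivalence GF FG.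
have wG := weak_equivalence_of_equivalence FG GF.
have [faF fuF _] := wF.
apply: (@lift_along_fully_faithful _ _ _ (comp_functor F (principal S)) (principal T)).
- by move=> e f s t /= /faF /principal_faithful.
- by move=> e f u; have [v <-] := fuF _ _ u; have [s <-] := principal_full v; exists s.
- exact: principal_faithful.
- exact: principal_full.
- move=> e; apply: (atomic_principal hT); apply: (weak_equivalence_atomic wF).
  exact: principal_atomic.
- move=> b; have /(atomic_principal hS)[a ab] : atomic (G (principal T b)).
    by apply: (weak_equivalence_atomic wG); exact: principal_atomic.
  exists a; apply: (@isomorphic_trans _ (F (G (principal T b)))).
    by apply: isomorphic_sym; exact: (isomorphic_fobj F ab).
  have [eps [epsi _]] := FG; exists (eps (principal T b)); exact: epsi.
Qed.

(** * Rewriting words in a semigroup *)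

Lemma mulg_prefix (S : semigroupType) (a b : S) : a = b -> forall t, t * a = t * b.
Proof. by move=> ->. Qed.

Lemma eq_of_idem (S : semigroupType) (e : S) : is_idem e -> e * e = e.
Proof. by []. Qed.

(** [word (h1, ..., hn)] rewrites with the given equations, from left to right,
    at any position within a product: left-associated products hide the factors
    of a word, so each equation is also used behind an arbitrary prefix. The last
    equation has priority, which matters when one of them undoes another. *)
Ltac word_eq h :=
  lazymatch type of h with
  | is_idem _ => constr:(eq_of_idem h)
  | _ => h
  end.

Ltac word_step h :=
  lazymatch h with
  | (?h1, ?h2) => first [word_step h2 | word_step h1]
  | _ =>
    let h := word_eq h in
    let p := constr:(mulg_prefix h) in
    lazymatch type of p with
    | forall _ : ?S, _ =>
      let q := constr:(fun prefix_ : S => ltac:(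
        let r := fresh in pose proof (p prefix_) as r; rewrite ?mulgA in r; exact r)) in
      let h' := constr:(ltac:(
        let r := fresh in pose proof h as r; rewrite ?mulgA in r; exact r)) in
      first [rewrite q | rewrite h']
    end
  end.

Ltac word h := rewrite ?mulgA; repeat (word_step h; rewrite ?mulgA); try done.

(** * Properties defined by idempotents and inverses *)

Section Characterisations.
Variable S : semigroupType.

Lemma regularP : regular S -> forall s : S, exists t, s * t * s = s /\ t * s * t = t.
Proof. by move=> reg s; have [t [st ts]] := reg s; exists t. Qed.

Lemma regular_of_inner : (forall s : S, exists t, s * t * s = s) -> regular S.
Proof.
move=> inn s; have [t st] := inn s; exists (t * s * t).
by split; word st.
Qed.

Lemma regular_local_units : regular S -> has_local_units S.
Proof.
move=> reg s; have [t [st _]] := regularP reg s; exists (s * t), (t * s).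
by rewrite /is_idem; split; word st.
Qed.

Lemma greenL_idem (a e : S) : is_idem e ->
  greenL a e <-> a * e = a /\ exists s, s * a = e.
Proof.
move=> ei; split=> [ae|[ae [s sa]]].
  have : left_ideal e a by rewrite -ae; left.
  have : left_ideal a e by rewrite ae; left.
  move=> ea eb; split; first by case: eb => [->|[s ->]]; word ei.
  by case: ea => [<-|[s ->]]; [exists e | exists s].
apply/seteqP; split=> x /=.
  by case=> [->|[t ->]]; right; [exists a | exists (t * a); rewrite -mulgA ae].
by case=> [->|[t ->]]; right; [exists s | exists (t * s); rewrite -mulgA sa].
Qed.

Lemma greenR_idem (a e : S) : is_idem e ->
  greenR a e <-> e * a = a /\ exists s, a * s = e.
Proof.
move=> ei; split=> [ae|[ae [s sa]]].
  have : right_ideal e a by rewrite -ae; left.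
  have : right_ideal a e by rewrite ae; left.
  move=> ea eb; split; first by case: eb => [->|[s ->]]; word ei.
  by case: ea => [<-|[s ->]]; [exists e | exists s].
apply/seteqP; split=> x /=.
  by case=> [->|[t ->]]; right; [exists a | exists (a * t); rewrite mulgA ae].
by case=> [->|[t ->]]; right; [exists s | exists (s * t); rewrite mulgA sa].
Qed.

Lemma greenL_idems (e f : S) : is_idem e -> is_idem f ->
  greenL e f <-> e * f = e /\ f * e = f.
Proof.
move=> ei fi; rewrite greenL_idem //; split=> [[ef [s sf]]|[ef fe]].
  by split=> //; rewrite -sf -mulgA ei.
by split=> //; exists f.
Qed.

Lemma greenR_idems (e f : S) : is_idem e -> is_idem f ->
  greenR e f <-> f * e = e /\ e * f = f.
Proof.
move=> ei fi; rewrite greenR_idem //; split=> [[ef [s sf]]|[ef fe]].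
  by split=> //; rewrite -sf mulgA ei.
by split=> //; exists f.
Qed.

Definition idempotents_commute : Prop :=
  forall e f : S, is_idem e -> is_idem f -> e * f = f * e.

(** If [t] is the inverse of [e f], then [f t e] is an idempotent inverse of
    [e f], so [t] is idempotent; being its own inverse, it equals [e f]. Hence
    [e f] and [f e] are idempotent and inverse to each other. *)
Lemma inverse_semigroupP :
  inverse_semigroup S <-> regular S /\ idempotents_commute.
Proof.
split=> [inv|[reg com] s]; last first.
  have [t [st ts]] := reg s; exists t; split=> // u [su us].
  move: st ts su us => /esym st /esym ts /esym su /esym us.
  have com1 : t * s * (u * s) = u * s * (t * s).
    by apply: com; rewrite /is_idem; word (st, su).
  have com2 : s * t * (s * u) = s * u * (s * t).
    by apply: com; rewrite /is_idem; word (st, su).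
  transitivity (t * s * (u * s) * t); first by word (su, ts).
  rewrite com1; transitivity (u * (s * t * (s * u))); first last.
    by word (st, us).
  by rewrite com2; word (st, ts, su, us).
split=> [s|]; first by have [t [st _]] := inv s; exists t.
have uniq (s t u : S) : is_inverse_of s t -> is_inverse_of s u -> t = u.
  by have [v [_ vu]] := inv s; move=> /vu <- /vu <-.
have idemM (e f : S) : is_idem e -> is_idem f -> is_idem (e * f).
  move=> ei fi; have [t [[/esym st /esym ts] _]] := inv (e * f).
  have ft : f * t * e = t.
    by apply: (uniq (e * f)); split; word (ei, fi, st, ts).
  have ti : is_idem t by rewrite /is_idem -ft; word ts.
  have : e * f = t by apply: (uniq t); split; word (ti, st, ts).
  by move=> ->.
move=> e f ei fi; have ef := idemM _ _ ei fi; have fe := idemM _ _ fi ei.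
by apply: (uniq (e * f)); split; move: ef fe; rewrite /is_idem => ef fe;
  word (ei, fi, ef, fe).
Qed.

Lemma L_unipotentP :
  L_unipotent S <-> regular S /\ forall e f : S, is_idem e -> is_idem f ->
    e * f = e -> f * e = f -> e = f.
Proof.
split=> [[reg uni]|[reg uni]]; split=> //.
  move=> e f ei fi ef fe; have [g [_ gu]] := uni e.
  rewrite -(gu e (conj ei _)) // -(gu f (conj fi _)) //.
  exact/(greenL_idems ei fi).
move=> a; have [b [ab ba]] := regularP reg a.
have bai : is_idem (b * a) by rewrite /is_idem; word ab.
exists (b * a); split.
  by split=> //; apply/(greenL_idem _ bai); split; [word ab|exists b].
move=> f [fi /(greenL_idem _ fi)[af [s sa]]]; apply: uni => //.
  by word af.
by rewrite -sa; word ab.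
Qed.

(** This says that [v u] is in the R-class of [v] and in the L-class of [u];
    equivalently, by the theorem of Clifford and Miller, that the intersection of
    the L-class of [v] and the R-class of [u] contains an idempotent. *)
Definition hits (v u : S) : Prop :=
  exists s t, v * u * s = v /\ t * v * u = u.

Definition hits_symmetric : Prop :=
  forall a c : S, is_idem a -> is_idem c -> hits a c -> hits c a.

(** The chain [e L f R g] makes [e g] lie in
    [R_e] and in [L_g], while [g e] lies in [R_g] and in [L_e] exactly when
    there is an idempotent in [R_e] and in [L_g]. *)
Lemma E_solidP : E_solid S <-> regular S /\ hits_symmetric.
Proof.
split=> [[reg sol]|[reg sym]]; split=> //.
  move=> a c ai ci [s [t [acs tac]]].
  pose f := c * s * a.
  have fi : is_idem f by rewrite /is_idem /f; word (ai, acs).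
  have af : greenL a f.
    by apply/(greenL_idems ai fi); rewrite /f; split; word (ai, acs).
  have fc : greenR f c.
    apply/(greenR_idems fi ci); rewrite /f; split; first by word ci.
    transitivity (t * a * c * s * a * c); first by rewrite tac.
    by word (tac, ai, acs).
  have [h [hi ah hc]] := sol _ _ _ ai fi ci af fc.
  move/(greenR_idems ai hi): ah => [ha ah]; move/(greenL_idems hi ci): hc => [hc ch].
  by exists h, h; split; word (ah, ha, hc, ch).
move=> e f g ei fi gi /(greenL_idems ei fi)[ef fe] /(greenR_idems fi gi)[gf fg].
have [s [t [ges tge]]] : hits g e.
  by apply: sym => //; exists f, f; split; word (gf, ef, fe, fg).
have hi : is_idem (e * s * g) by rewrite /is_idem; word (ges, gi).
exists (e * s * g); split=> //.
  apply/(greenR_idems ei hi); split; last by word ei.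
  transitivity (t * g * e * s * g * e); first by rewrite tge.
  by word (tge, gi, ges).
by apply/(greenL_idems hi gi); split; word (ges, gi).
Qed.

Lemma union_of_groupsP :
  union_of_groups S <-> forall a : S, exists b, a * b * a = a /\ a * b = b * a.
Proof.
split=> [ug a|ug].
  have : [set: S]%classic a by []; rewrite -ug.
  move=> [H [e [_ _ eH inv]] Ha]; have [b [Hb ab ba]] := inv a Ha.
  by exists b; rewrite ab ba; split=> //; have [] := eH a Ha.
apply/seteqP; split=> // a _; have [b [aba ab']] := ug a.
have [e [ab ba]] : exists e, a * b = e /\ b * a = e by exists (a * b).
have ea : e * a = a by rewrite -ab.
have ae : a * e = a by rewrite -ba mulgA.
have ei : e * e = e by rewrite -{2}ab mulgA ea ab.
exists [set x | [/\ e * x = x, x * e = x & exists y,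
  [/\ e * y = y, y * e = y, x * y = e & y * x = e]]]%classic; last first.
  split=> //; exists (e * b * e); split; word (ea, ae, ab, ba, ei).
exists e; split=> [|x y [ex xe [x' [ex' xe' xx' x'x]]]
  [ey ye [y' [ey' ye' yy' y'y]]]|x []//|].
- by split=> //; exists e.
- split; [by word ex|by word ye|].
  exists (y' * x').
  by split; word (ex', ey', xe', ye', xe, ex, ye, ey, xx', x'x, yy', y'y).
- move=> x [ex xe [x' [ex' xe' xx' x'x]]]; exists x'; split=> //; split=> //.
  by exists x.
Qed.

End Characterisations.

(** * Local submonoids *)

Definition between (S : semigroupType) (e f x : S) : Prop :=
  e * x = x /\ x * f = x.

(** This covers both the inclusion of a local submonoid of [S] and its image in
    [T] under an equivalence of Karoubi envelopes. *)
Definition corner_embedding (M T : semigroupType) (f : M -> T) (k : T) : Prop :=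
  [/\ forall x y, f (x * y) = f x * f y, injective f, is_idem k,
      forall x, between k k (f x)
    & forall t, between k k t -> exists x, f x = t].

Section CornerEmbedding.
Variables (M T : semigroupType) (f : M -> T) (k : T).
Hypothesis fk : corner_embedding f k.

Lemma corner_embedding_cut (t : T) : exists x, f x = k * t * k.
Proof. by have [_ _ ki _ sur] := fk; apply: sur; split; word ki. Qed.

Lemma corner_embedding_idem (x : M) : is_idem (f x) <-> is_idem x.
Proof.
have [fM fI _ _ _] := fk; split; rewrite /is_idem -fM; first exact: fI.
by move=> ->.
Qed.

Lemma corner_regular : regular T -> regular M.
Proof.
have [fM fI ki kk _] := fk; move=> reg; apply: regular_of_inner => x.
have [t [xtx _]] := regularP reg (f x); have [y fy] := corner_embedding_cut t.
have [kx xk] := kk x; exists y; apply: fI; rewrite !fM fy.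
by word (kx, xk, xtx).
Qed.

Lemma corner_inverse_semigroup : inverse_semigroup T -> inverse_semigroup M.
Proof.
have [fM fI _ _ _] := fk; move=> /inverse_semigroupP[reg com].
apply/inverse_semigroupP; split; first exact: corner_regular.
by move=> x y /corner_embedding_idem xi /corner_embedding_idem yi;
  apply: fI; rewrite !fM com.
Qed.

Lemma corner_semilattice : semilattice T -> semilattice M.
Proof.
have [fM fI _ _ _] := fk; move=> [com idm]; split=> [x y|x].
  by apply: fI; rewrite !fM com.
exact/corner_embedding_idem/idm.
Qed.

Lemma corner_orthodox : orthodox T -> orthodox M.
Proof.
have [fM _ _ _ _] := fk; move=> [reg idM]; split; first exact: corner_regular.
move=> x y /corner_embedding_idem xi /corner_embedding_idem yi.
by apply/corner_embedding_idem; rewrite fM; exact: idM.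
Qed.

Lemma corner_L_unipotent : L_unipotent T -> L_unipotent M.
Proof.
have [fM fI _ _ _] := fk; move=> /L_unipotentP[reg uni].
apply/L_unipotentP; split; first exact: corner_regular.
move=> x y /corner_embedding_idem xi /corner_embedding_idem yi xy yx.
by apply/fI/uni => //; rewrite -fM ?xy ?yx.
Qed.

Lemma corner_hits (x y : M) : hits (f x) (f y) <-> hits x y.
Proof.
have [fM fI ki kk _] := fk; split=> [[s [t [xys txy]]]|[s [t [xys txy]]]].
  have [s' fs] := corner_embedding_cut s; have [t' ft] := corner_embedding_cut t.
  have [[kx xk] [ky yk]] := (kk x, kk y); exists s', t'; split.
    by apply: fI; rewrite !fM fs; word (yk, xys, xk).
  by apply: fI; rewrite !fM ft; word (kx, txy, ky); rewrite txy.
by exists (f s), (f t); rewrite -!fM xys txy.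
Qed.

Lemma corner_E_solid : E_solid T -> E_solid M.
Proof.
move=> /E_solidP[reg sym]; apply/E_solidP; split; first exact: corner_regular.
move=> x y /corner_embedding_idem xi /corner_embedding_idem yi /corner_hits xy.
by apply/corner_hits; exact: sym.
Qed.

Lemma corner_union_of_groups : union_of_groups T -> union_of_groups M.
Proof.
have [fM fI ki kk _] := fk; move=> /union_of_groupsP ug.
apply/union_of_groupsP => x; have [t [xtx xt]] := ug (f x).
have [kx xk] := kk x; have [y fy] := corner_embedding_cut t; exists y.
split; apply: fI; rewrite !fM fy; first by word (kx, xk, xtx).
have ktx : k * t * f x = f x * t by rewrite -mulgA -xt; word kx.
have xtk : f x * t * k = f x * t by rewrite xt; word xk.
by word (xk, kx); rewrite ktx xtk.
Qed.

End CornerEmbedding.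

Section LocalSubmonoids.
Variable S : semigroupType.

Lemma local_submonoid_embedding (e : S) : is_idem e ->
  corner_embedding (val : local_submonoid e -> S) e.
Proof.
move=> ei; split=> // [|x|t [et te]]; first exact: val_inj.
  by have := valP x; rewrite inE => -[s _ <-]; split; word ei.
have te' : t \in local_set e by rewrite inE; exists t => //; rewrite et te.
by exists (Sub t te'); rewrite SubK.
Qed.

Lemma Karoubi_embedding (T : semigroupType) (K : functor (Karoubi S) (Karoubi T))
    (e : idem S) : weak_equivalence K ->
  exists f : local_submonoid (val e) -> T, corner_embedding f (val (K e)).
Proof.
move=> [faK fuK _].
have [_ _ _ vk _] := local_submonoid_embedding (idemE e).
pose c (x : local_submonoid (val e)) : corner e e :=
  mkCorner (proj1 (vk x)) (proj2 (vk x)).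
exists (fun x => val (fmap K (c x : @hom (Karoubi S) e e))); split.
- move=> x y; rewrite -fmap_val_comp; congr (val (fmap K _)); exact: val_inj.
- move=> x y xy; apply: val_inj.
  by have /(congr1 val) := faK _ _ _ _ (val_inj xy).
- exact: idemE.
- by move=> x; split; [exact: corner_l | exact: corner_r].
- move=> t [et te]; have [u uE] := fuK e e (mkCorner et te).
  have [_ _ _ _ sur] := local_submonoid_embedding (idemE e).
  have [x xE] := sur (val u) (conj (corner_l u) (corner_r u)).
  exists x; rewrite -[RHS]/(val (mkCorner et te)) -uE.
  by congr (val (fmap K _)); exact: val_inj.
Qed.

Lemma locally_has_of_Karoubi (P : semigroupType -> Prop) (T : semigroupType)
    (K : functor (Karoubi S) (Karoubi T)) :
  (forall (M : semigroupType) (f : M -> T) k, corner_embedding f k -> P T -> P M) ->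
  weak_equivalence K -> P T -> locally_has P S.
Proof.
move=> transfer hK PT e ei.
by have [f fk] := Karoubi_embedding (mkIdem ei) hK; exact: transfer fk PT.
Qed.

Lemma regular_of_Karoubi (T : semigroupType)
    (K : functor (Karoubi S) (Karoubi T)) :
  has_local_units S -> weak_equivalence K -> regular T -> regular S.
Proof.
move=> hS [faK fuK _] reg; apply: regular_of_inner => s.
have [e [f [ei fi es sf]]] := hS s.
pose s' : @hom (Karoubi S) (mkIdem ei) (mkIdem fi) :=
  mkCorner (e := mkIdem ei) (f := mkIdem fi) es sf.
have [t [sts _]] := regularP reg (val (fmap K s')).
have t1 : val (K (mkIdem fi)) * (val (K (mkIdem fi)) * t * val (K (mkIdem ei)))
    = val (K (mkIdem fi)) * t * val (K (mkIdem ei)) by rewrite !mulgA idemE.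
have t2 : (val (K (mkIdem fi)) * t * val (K (mkIdem ei))) * val (K (mkIdem ei))
    = val (K (mkIdem fi)) * t * val (K (mkIdem ei)) by rewrite -mulgA idemE.
have [u uE] := fuK _ _ (mkCorner t1 t2); exists (val u).
suff /(congr1 val) : compm (compm s' u) s' = s' by rewrite /= mulgA.
apply: faK; apply: val_inj; rewrite !fmap_val_comp uE /= -[in RHS]sts.
by rewrite !mulgA corner_r -!mulgA corner_l.
Qed.

End LocalSubmonoids.

(** * The order of principal ideals *)

Section PrincipalIdeals.
Variable S : semigroupType.

Definition jle (x y : S) : Prop := exists a b, x = a * y * b.

Lemma jle_trans (y x z : S) : jle x y -> jle y z -> jle x z.
Proof.
move=> [a [b ->]] [c [d ->]]; exists (a * c), (d * b); by rewrite !mulgA.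
Qed.

Lemma jle_two_sided (x y : S) : regular S ->
  (two_sided_ideal x `<=` two_sided_ideal y)%classic <-> jle x y.
Proof.
move=> reg; split=> [sub|[a [b ->]] z].
  have [y' [yy _]] := regularP reg y.
  have : two_sided_ideal y x by apply: sub; constructor.
  case=> [->|[s ->]|[t ->]|[s [t ->]]].
  - by exists (y * y'), (y' * y); word yy.
  - by exists s, (y' * y); word yy.
  - by exists (y * y'), t; word yy.
  - by exists s, t.
case=> [->|[s ->]|[t ->]|[s [t ->]]]; apply: Or44.
- by exists a, b.
- by exists (s * a), b; rewrite !mulgA.
- by exists a, (b * t); rewrite !mulgA.
- by exists (s * a), (b * t); rewrite !mulgA.
Qed.

Definition jmeet (x y z : S) : Prop :=
  [/\ jle z x, jle z y & forall w, jle w x -> jle w y -> jle w z].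

Lemma meet_semilattice_jmeetP : regular S ->
  meet_semilattice_under_inclusion (@J_classes S) <->
  forall x y : S, exists z, jmeet x y z.
Proof.
move=> reg; have sub := fun x y => jle_two_sided x y reg.
split=> [meet x y|meet A B [x _ <-] [y _ <-]].
  have [||_ [[z _ <-] /sub zx /sub zy zw]] :=
    meet (two_sided_ideal x) (two_sided_ideal y).
  - by exists x.
  - by exists y.
  exists z; split=> // w /sub wx /sub wy; apply/sub/zw => //; by exists w.
have [z [zx zy zw]] := meet x y; exists (two_sided_ideal z).
split; [by exists z | exact/sub | exact/sub |].
by move=> D [w _ <-] /sub wx /sub wy; exact/sub/zw.
Qed.

(** The order of principal ideals is categorical: for idempotents it says that
    one is a retract of the other in the Karoubi envelope. *)
Lemma jle_retractP (e f : Karoubi S) : jle (val e) (val f) <->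
  exists (u : hom e f) (v : hom f e), compm v u = idm e.
Proof.
split=> [[a [b eab]]|[u [v /(congr1 val) /= uv]]]; last first.
  by exists (val u), (val v); rewrite corner_r.
have [ei fi] := (idemE e, idemE f).
have u1 : val e * (val e * a * val f) = val e * a * val f by word ei.
have u2 : val e * a * val f * val f = val e * a * val f by word fi.
have v1 : val f * (val f * b * val e) = val f * b * val e by word fi.
have v2 : val f * b * val e * val e = val f * b * val e by word ei.
exists (mkCorner u1 u2), (mkCorner v1 v2); apply: val_inj => /=.
by word (fi, esym eab); word ei.
Qed.

End PrincipalIdeals.

Section MeetKaroubi.
Variables (S T : semigroupType) (K : functor (Karoubi S) (Karoubi T)).
Hypotheses (hK : weak_equivalence K) (regS : regular S) (regT : regular T).

Lemma jle_Karoubi (e f : Karoubi S) :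
  jle (val e) (val f) <-> jle (val (K e)) (val (K f)).
Proof.
have [faK fuK _] := hK; split=> /jle_retractP[u [v uv]]; apply/jle_retractP.
  by exists (fmap K u), (fmap K v); rewrite -fmapM uv fmap1.
have [u' u'E] := fuK _ _ u; have [v' v'E] := fuK _ _ v; exists u', v'.
by apply: faK; rewrite fmapM u'E v'E fmap1.
Qed.

Lemma regular_jle_idem (M : semigroupType) (x : M) : regular M ->
  exists e : Karoubi M, jle x (val e) /\ jle (val e) x.
Proof.
move=> reg; have [x' [xx x'x]] := regularP reg x.
have ei : is_idem (x * x') by rewrite /is_idem; word xx.
exists (mkIdem ei); split; [exists (x * x'), x|exists (x * x'), x'] => /=;
  by word xx.
Qed.

Lemma jmeet_Karoubi : (forall x y : T, exists z, jmeet x y z) ->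
  forall x y : S, exists z, jmeet x y z.
Proof.
move=> meet x y.
have [e [xe ex]] := regular_jle_idem x regS.
have [f [yf fy]] := regular_jle_idem y regS.
have [z [ze zf zw]] := meet (val (K e)) (val (K f)).
have [g [zg gz]] := regular_jle_idem z regT.
have [_ _ /(_ g)[h [u [v [vu uv]]]]] := hK.
have hg : jle (val (K h)) (val g) by apply/jle_retractP; exists u, v.
have gh : jle (val g) (val (K h)) by apply/jle_retractP; exists v, u.
exists (val h); split.
- apply: jle_trans ex; apply/jle_Karoubi; apply: jle_trans hg _.
  exact: jle_trans gz ze.
- apply: jle_trans fy; apply/jle_Karoubi; apply: jle_trans hg _.
  exact: jle_trans gz zf.
- move=> w wx wy; have [k [wk kw]] := regular_jle_idem w regS.
  apply: (jle_trans wk); apply/jle_Karoubi; apply: jle_trans gh.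
  apply: (jle_trans _ zg); apply: zw; apply/jle_Karoubi; apply: (jle_trans kw).
    exact: jle_trans wx xe.
  exact: jle_trans wy yf.
Qed.

End MeetKaroubi.

Lemma union_of_groups_regular (S : semigroupType) : union_of_groups S -> regular S.
Proof.
by move=> /union_of_groupsP ug; apply: regular_of_inner => s;
  have [t []] := ug s; exists t.
Qed.

Lemma semilattice_union_of_groups (S : semigroupType) :
  semilattice S -> union_of_groups S.
Proof.
move=> [_ idm]; apply/union_of_groupsP => a; exists a.
by have := idm a; rewrite /is_idem => ai; split; word ai.
Qed.

(** In a union of groups, [x] and [x x] generate the same ideal. Hence an element
    [w = a x b = c y d] lies in the ideal of [w w], so in that of
    [v = y d a x], and so in the ideal of [v v = y d a (x y) d a x]. *)
Lemma union_of_groups_jmeet (S : semigroupType) : union_of_groups S ->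
  forall x y : S, jmeet x y (x * y).
Proof.
move=> /union_of_groupsP ug x y; split.
- by have [s [xsx _]] := ug x; exists (x * s), y; rewrite xsx.
- by have [s [ysy _]] := ug y; exists x, (s * y); word ysy.
move=> w [a [b wab]] [c [d wcd]].
have [s [wsw ws]] := ug w; have [u [vuv vu]] := ug (y * d * a * x).
exists (c * y * d * a), (d * a * x * u * b * s).
have -> : w = w * w * s by rewrite -mulgA ws mulgA wsw.
rewrite {1}wcd {1}wab; transitivity (c * (y * d * a * x) * b * s).
  by rewrite !mulgA.
by rewrite -{1}vuv -[in LHS](mulgA (y * d * a * x)) -vu !mulgA.
Qed.

(** * Consolidations of the Karoubi envelope *)

(** The connecting elements through which composition is extended to pairs of
    morphisms that are not composable. *)
Record sandwich (S : semigroupType) := Sandwich {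
  sw :> S -> S -> S;
  sw_between : forall e f, is_idem e -> is_idem f -> between e f (sw e f);
  sw_id : forall e, is_idem e -> sw e e = e }.

Section Consolidation.
Variables (S : semigroupType) (p : sandwich S).

Definition consolidation of sandwich S : Type :=
  {a : S * S * S | [&& a.1.1 * a.1.1 == a.1.1, a.2 * a.2 == a.2,
                       a.1.1 * a.1.2 == a.1.2 & a.1.2 * a.2 == a.1.2]}.

HB.instance Definition _ := Choice.on (consolidation p).

Notation T := (consolidation p).

Definition src (a : T) : S := (val a).1.1.
Definition elt (a : T) : S := (val a).1.2.
Definition tgt (a : T) : S := (val a).2.

Lemma src_idem (a : T) : is_idem (src a).
Proof. by have /and4P[/eqP] := valP a. Qed.

Lemma tgt_idem (a : T) : is_idem (tgt a).
Proof. by have /and4P[_ /eqP] := valP a. Qed.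

Lemma elt_src (a : T) : src a * elt a = elt a.
Proof. by have /and4P[_ _ /eqP] := valP a. Qed.

Lemma elt_tgt (a : T) : elt a * tgt a = elt a.
Proof. by have /and4P[_ _ _ /eqP] := valP a. Qed.

Lemma mkCons_subproof (e f x : S) : is_idem e -> is_idem f -> between e f x ->
  [&& e * e == e, f * f == f, e * x == x & x * f == x].
Proof. by move=> -> -> [-> ->]; rewrite !eqxx. Qed.

Definition mkCons (e f x : S) (ei : is_idem e) (fi : is_idem f)
    (exf : between e f x) : T :=
  exist _ (e, x, f) (mkCons_subproof ei fi exf).

Lemma cons_eq (a b : T) :
  src a = src b -> elt a = elt b -> tgt a = tgt b -> a = b.
Proof.
move=> ab1 ab2 ab3; apply: val_inj; move: ab1 ab2 ab3; rewrite /src /elt /tgt.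
by case: (val a) => [[? ?] ?]; case: (val b) => [[? ?] ?] /= -> -> ->.
Qed.

Lemma sw_l (a b : T) : tgt a * p (tgt a) (src b) = p (tgt a) (src b).
Proof. by have [] := sw_between p (tgt_idem a) (src_idem b). Qed.

Lemma sw_r (a b : T) : p (tgt a) (src b) * src b = p (tgt a) (src b).
Proof. by have [] := sw_between p (tgt_idem a) (src_idem b). Qed.

Lemma cons_mul_between (a b : T) :
  between (src a) (tgt b) (elt a * p (tgt a) (src b) * elt b).
Proof. by split; [word (elt_src a) | rewrite -mulgA elt_tgt]; rewrite ?elt_src. Qed.

Definition cons_mul (a b : T) : T :=
  mkCons (src_idem a) (tgt_idem b) (cons_mul_between a b).

Lemma cons_mulA : associative cons_mul.
Proof. by move=> a b c; apply: cons_eq; rewrite /elt //= !mulgA. Qed.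

HB.instance Definition _ := isSemigroup.Build T cons_mulA.

Lemma srcM (a b : T) : src (a * b) = src a. Proof. by []. Qed.
Lemma tgtM (a b : T) : tgt (a * b) = tgt b. Proof. by []. Qed.
Lemma eltM (a b : T) : elt (a * b) = elt a * p (tgt a) (src b) * elt b.
Proof. by []. Qed.

Definition arrow (e f : Karoubi S) (s : hom e f) : T :=
  mkCons (idemE e) (idemE f) (conj (corner_l s) (corner_r s)).

Lemma arrowM (e f g : Karoubi S) (t : hom f g) (s : hom e f) :
  arrow (compm t s) = arrow s * arrow t.
Proof.
apply: cons_eq => //; rewrite eltM /src /tgt /elt /=.
by rewrite (sw_id p (idemE f)) corner_r.
Qed.

Lemma arrow_idem (e : Karoubi S) : is_idem (arrow (idm e)).
Proof. by rewrite /is_idem -arrowM comp1m. Qed.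

Definition cons_obj (e : Karoubi S) : Karoubi T := mkIdem (arrow_idem e).

Lemma cons_hom_l (e f : Karoubi S) (s : hom e f) :
  val (cons_obj e) * arrow s = arrow s.
Proof. by rewrite /= -arrowM compm1. Qed.

Lemma cons_hom_r (e f : Karoubi S) (s : hom e f) :
  arrow s * val (cons_obj f) = arrow s.
Proof. by rewrite /= -arrowM comp1m. Qed.

Definition cons_hom (e f : Karoubi S) (s : hom e f) :
    @hom (Karoubi T) (cons_obj e) (cons_obj f) :=
  mkCorner (cons_hom_l s) (cons_hom_r s).

Lemma cons_fmap1 (e : Karoubi S) : cons_hom (idm e) = idm (cons_obj e).
Proof. exact: val_inj. Qed.

Lemma cons_fmapM (e f g : Karoubi S) (t : hom f g) (s : hom e f) :
  cons_hom (compm t s) = compm (cons_hom t) (cons_hom s).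
Proof. by apply: val_inj; rewrite /= arrowM. Qed.

Definition cons_functor : functor (Karoubi S) (Karoubi T) :=
  Functor cons_fmap1 cons_fmapM.

(** An idempotent [(e, x, f)] of the consolidation satisfies [x p x = x], with
    [p = p_(f, e)]; it is isomorphic to the idempotent [x p] of [S]. *)
Lemma cons_weak_equivalence : weak_equivalence cons_functor.
Proof.
split=> [e f s t /(congr1 (fun u => elt (val u)))|e f u|a].
- by rewrite /elt /= => st; exact: val_inj.
- have us : src (val u) = val e by rewrite -[in LHS](corner_l u).
  have ut : tgt (val u) = val f by rewrite -[in LHS](corner_r u).
  have eu : val e * elt (val u) = elt (val u) by rewrite -us elt_src.
  have uf : elt (val u) * val f = elt (val u) by rewrite -ut elt_tgt.
  by exists (mkCorner eu uf); apply: val_inj; apply: cons_eq.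
- have ai : val a * val a = val a := idemE a.
  have xpx := congr1 elt ai; rewrite eltM in xpx.
  set x := elt (val a) in xpx; set e := src (val a) in xpx.
  set f := tgt (val a) in xpx; set q := p f e in xpx.
  have [fq qe] : between f e q by exact: sw_between (tgt_idem _) (src_idem _).
  have [ex xf] : between e f x by split; [exact: elt_src | exact: elt_tgt].
  have gi : is_idem (x * q) by rewrite /is_idem; word xpx.
  exists (mkIdem gi); apply/isomorphic_KaroubiP.
  have sb : between (x * q) f x by split.
  have tb : between e (x * q) (x * q) by split; [word ex | exact: gi].
  exists (mkCons gi (tgt_idem (val a)) sb), (mkCons (src_idem (val a)) gi tb).
  split; apply: cons_eq => //; rewrite eltM /src /elt /tgt /= -/x -/e -/f -/q.
  + by rewrite (sw_id p gi); word xpx.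
  + by rewrite (sw_id p gi) -[RHS]/x; word xpx.
Qed.

Lemma cons_regular : regular S -> regular T.
Proof.
move=> reg; apply: regular_of_inner => a; have [t [ata tat]] := regularP reg (elt a).
have tb : between (tgt a) (src a) (tgt a * t * src a).
  by split; [word (tgt_idem a) | rewrite -mulgA src_idem].
exists (mkCons (tgt_idem a) (src_idem a) tb); apply: cons_eq => //.
rewrite !eltM !tgtM /src /tgt /elt /= -/(src a) -/(tgt a) -/(elt a).
rewrite !(sw_id p (tgt_idem a)) !(sw_id p (src_idem a)).
by word (tgt_idem a, src_idem a, elt_src a, elt_tgt a, ata).
Qed.

Lemma cons_idemP (a : T) : is_idem a <-> elt a * p (tgt a) (src a) * elt a = elt a.
Proof.
by split=> [/(congr1 elt)|aa]; [rewrite eltM | apply: cons_eq].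
Qed.

End Consolidation.

(** * The largest congruence that is injective on local submonoids *)

Section LocalQuotient.
Variable T : semigroupType.

Definition locally_equal (a b : T) : Prop := forall x y, x * a * y = x * b * y.

Lemma locally_equal_conv (a b : T) :
  clos_refl_sym_trans _ locally_equal a b <-> locally_equal a b.
Proof.
split; last exact: rst_step.
elim=> [//|//|u v _ uv x y|u v w _ uv _ vw x y]; first by rewrite uv.
by rewrite uv.
Qed.

Definition local_quotient : Type := quot locally_equal.
Notation Q := local_quotient.

HB.instance Definition _ := Choice.on Q.

Definition lcls (a : T) : Q := cls locally_equal a.

Lemma lclsP (a b : T) : lcls a = lcls b <-> locally_equal a b.
Proof. by rewrite /lcls clsP locally_equal_conv. Qed.

Lemma lcls_surj (z : Q) : exists a, z = lcls a.
Proof. exact: cls_surj. Qed.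

Definition lmul (y z : Q) : Q := lcls (repr (y : quot _) * repr (z : quot _)).

Lemma locally_equalMr (a b c : T) :
  locally_equal a b -> locally_equal (a * c) (b * c).
Proof. by move=> ab x y; have := ab x (c * y); rewrite !mulgA. Qed.

Lemma lmulE (a b : T) : lmul (lcls a) (lcls b) = lcls (a * b).
Proof.
rewrite /lmul (repr_lift _ (fun a' => lcls (a' * _))); last first.
  by move=> u v uv; apply/lclsP/locally_equalMr.
rewrite (repr_lift _ (fun b' => lcls (a * b'))) // => u v uv.
by apply/lclsP => x y; rewrite !mulgA uv.
Qed.

Lemma lmulA : associative lmul.
Proof.
move=> x y z; have [a ->] := lcls_surj x; have [b ->] := lcls_surj y.
by have [c ->] := lcls_surj z; rewrite !lmulE mulgA.
Qed.

HB.instance Definition _ := isSemigroup.Build Q lmulA.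

Lemma lclsM (a b : T) : lcls (a * b) = lcls a * lcls b.
Proof. by rewrite -[RHS]/(lmul _ _) lmulE. Qed.

Lemma lcls_inj_between (e f a b : T) : between e f a -> between e f b ->
  lcls a = lcls b -> a = b.
Proof. by move=> [ea af] [eb bf] /lclsP/(_ e f); rewrite ea af eb bf. Qed.

Lemma lcls_idem_lift (z : Q) : is_idem z -> exists2 e, is_idem e & z = lcls e.
Proof.
have [a ->] := lcls_surj z; rewrite /is_idem -lclsM => /lclsP aa.
(* [a] need not be idempotent, but [a a a] is: multiply [a a] and [a], which are
   locally equal, by [a] on both sides. *)
have a4 : a * a * a * a = a * a * a by have := aa a a; rewrite !mulgA.
exists (a * a * a); first by rewrite /is_idem; word a4.
by apply/lclsP => x y; have := aa (x * a) y; have := aa x y; rewrite !mulgA => -> ->.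
Qed.

Lemma local_quotient_regular : regular T -> regular Q.
Proof.
move=> reg; apply: regular_of_inner => z; have [a ->] := lcls_surj z.
have [b [aba _]] := regularP reg a; exists (lcls b).
by rewrite -(lclsM a b) -(lclsM (a * b) a) aba.
Qed.

(** As [x = x (x' x)] and [y = (y y') y], products with idempotents on both sides
    determine the products with [x] and [y]. *)
Lemma lcls_eq_idem (a b : T) : regular T ->
  (forall e f, is_idem e -> is_idem f -> e * a * f = e * b * f) ->
  lcls a = lcls b.
Proof.
move=> reg ab; apply/lclsP => x y.
have [x' [xx _]] := regularP reg x; have [y' [yy _]] := regularP reg y.
have ei : is_idem (x' * x) by rewrite /is_idem; word xx.
have fi : is_idem (y * y') by rewrite /is_idem; word yy.
by have := congr1 (fun u => x * u * y) (ab _ _ ei fi); word (xx, yy).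
Qed.

Lemma lcls_obj_subproof (e : Karoubi T) : is_idem (lcls (val e)).
Proof. by rewrite /is_idem -lclsM idemE. Qed.

Definition lcls_obj (e : Karoubi T) : Karoubi Q := mkIdem (lcls_obj_subproof e).

Lemma lcls_hom_l (e f : Karoubi T) (s : hom e f) :
  val (lcls_obj e) * lcls (val s) = lcls (val s).
Proof. by rewrite /= -lclsM corner_l. Qed.

Lemma lcls_hom_r (e f : Karoubi T) (s : hom e f) :
  lcls (val s) * val (lcls_obj f) = lcls (val s).
Proof. by rewrite /= -lclsM corner_r. Qed.

Definition lcls_hom (e f : Karoubi T) (s : hom e f) :
    @hom (Karoubi Q) (lcls_obj e) (lcls_obj f) :=
  mkCorner (lcls_hom_l s) (lcls_hom_r s).

Lemma lcls_fmap1 (e : Karoubi T) : lcls_hom (idm e) = idm (lcls_obj e).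
Proof. exact: val_inj. Qed.

Lemma lcls_fmapM (e f g : Karoubi T) (t : hom f g) (s : hom e f) :
  lcls_hom (compm t s) = compm (lcls_hom t) (lcls_hom s).
Proof. by apply: val_inj; rewrite /= lclsM. Qed.

Definition lcls_functor : functor (Karoubi T) (Karoubi Q) :=
  Functor lcls_fmap1 lcls_fmapM.

Lemma lcls_weak_equivalence : weak_equivalence lcls_functor.
Proof.
split=> [e f s t /(congr1 val) /= st|e f u|z].
- apply: val_inj; apply: lcls_inj_between st; split;
    by [exact: corner_l | exact: corner_r].
- have [a ua] := lcls_surj (val u).
  have l1 : val e * (val e * a * val f) = val e * a * val f by rewrite !mulgA idemE.
  have r1 : val e * a * val f * val f = val e * a * val f by rewrite -mulgA idemE.
  exists (mkCorner l1 r1); apply: val_inj => /=.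
  by rewrite !lclsM -ua -[in RHS](corner_r u) -[in RHS](corner_l u).
- have [e ei ze] := lcls_idem_lift (idemE z); exists (mkIdem ei).
  have zi : val (lcls_obj (mkIdem ei)) = val z by rewrite ze.
  apply/isomorphic_KaroubiP; exists (val z), (val z).
  by rewrite zi; split; exact: idemE.
Qed.

End LocalQuotient.

Lemma morita_consolidation (S : semigroupType) (p : sandwich S) :
  regular S -> morita_equivalent S (consolidation p).
Proof.
move=> reg; apply: (morita_of_Karoubi _ _ (cons_weak_equivalence p)).
  exact: regular_local_units.
exact/regular_local_units/cons_regular.
Qed.

Lemma morita_local_quotient (S : semigroupType) (p : sandwich S) :
  regular S -> morita_equivalent S (local_quotient (consolidation p)).
Proof.
move=> reg.
have hT := regular_local_units (@cons_regular _ p reg).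
apply: (@morita_of_Karoubi _ _ (comp_functor (lcls_functor _) (cons_functor p))).
- exact: regular_local_units.
- exact/regular_local_units/local_quotient_regular/cons_regular.
- exact: weak_equivalence_comp (cons_weak_equivalence p) (lcls_weak_equivalence _).
Qed.

(** * Local properties in terms of elements *)

Lemma locally_has_mono (P Q : semigroupType -> Prop) (S : semigroupType) :
  (forall M, P M -> Q M) -> locally_has P S -> locally_has Q S.
Proof. by move=> PQ loc e ei; exact/PQ/loc. Qed.

Section LocalElements.
Variables (S : semigroupType) (e : S).
Hypothesis ei : is_idem e.

Definition local_idem (x : S) : Prop := between e e x /\ is_idem x.

Lemma local_lift (x : S) : between e e x ->
  exists m : local_submonoid e, val m = x.
Proof. by have [_ _ _ _ sur] := local_submonoid_embedding ei; exact: sur. Qed.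

Lemma local_idem_lift (x : S) : local_idem x ->
  exists2 m : local_submonoid e, is_idem m & val m = x.
Proof.
move=> [xb xi]; have [m mx] := local_lift xb; exists m => //.
by apply/(corner_embedding_idem (local_submonoid_embedding ei)); rewrite mx.
Qed.

Lemma locally_inverse_comm (x y : S) : locally_has inverse_semigroup S ->
  local_idem x -> local_idem y -> x * y = y * x.
Proof.
move=> /(_ e ei)/inverse_semigroupP[_ com] /local_idem_lift[m mi <-].
by move=> /local_idem_lift[n ni <-]; exact: (congr1 val (com m n mi ni)).
Qed.

Lemma local_idemM (x y : S) : locally_has orthodox S ->
  local_idem x -> local_idem y -> local_idem (x * y).
Proof.
move=> /(_ e ei)[_ idM] [[ex xe] xi] [[ey ye] yi]; split.
  by split; [word ex | word ye].
have [m mi mx] := local_idem_lift (conj (conj ex xe) xi).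
have [n ni ny] := local_idem_lift (conj (conj ey ye) yi).
by rewrite -mx -ny; exact: (congr1 val (idM m n mi ni)).
Qed.

Lemma locally_L_unipotent_eq (x y : S) : locally_has L_unipotent S ->
  local_idem x -> local_idem y -> x * y = x -> y * x = y -> x = y.
Proof.
move=> /(_ e ei)/L_unipotentP[_ uni] /local_idem_lift[m mi <-].
by move=> /local_idem_lift[n ni <-] mn nm; congr val; apply: uni => //; exact: val_inj.
Qed.

Lemma locally_E_solid_hits (x y : S) : locally_has E_solid S ->
  local_idem x -> local_idem y -> hits x y -> hits y x.
Proof.
have em := local_submonoid_embedding ei.
move=> /(_ e ei)/E_solidP[_ sym] /local_idem_lift[m mi <-].
by move=> /local_idem_lift[n ni <-] /(corner_hits em) mn; apply/(corner_hits em)/sym.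
Qed.

Lemma locally_union_of_groups_inv (x : S) : locally_has union_of_groups S ->
  between e e x -> exists y, [/\ between e e y, x * y * x = x & x * y = y * x].
Proof.
have [_ _ _ bt _] := local_submonoid_embedding ei.
move=> /(_ e ei)/union_of_groupsP ug /local_lift[m <-]; have [n [mnm mn]] := ug m.
exists (val n); split; first exact: bt.
  exact: (congr1 val mnm).
exact: (congr1 val mn).
Qed.

Lemma locally_semilattice_elt (x y : S) : locally_has semilattice S ->
  between e e x -> between e e y -> is_idem x /\ x * y = y * x.
Proof.
move=> /(_ e ei)[com idm] /local_lift[m <-] /local_lift[n <-]; split.
  exact: (congr1 val (idm m)).
exact: (congr1 val (com m n)).
Qed.

End LocalElements.

Lemma inverse_orthodox (S : semigroupType) : inverse_semigroup S -> orthodox S.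
Proof.
move=> /inverse_semigroupP[reg com]; split=> // e f ei fi.
by rewrite /is_idem mulgA -(mulgA e) (com f e) //; word (ei, fi).
Qed.

(** For an inverse [t] of [e f], the idempotent [g = f t e] satisfies
    [e f = e g f] and [f g = g = g e]. Then [e g] is an idempotent in the L-class
    of [g], so [e g = g], and [e f = g f] is idempotent. *)
Lemma L_unipotent_orthodox (S : semigroupType) : L_unipotent S -> orthodox S.
Proof.
move=> /L_unipotentP[reg uni]; split=> // e f ei fi.
have [t [st ts]] := regularP reg (e * f); rewrite !mulgA in st ts.
have [g gE] : exists g, g = f * t * e by exists (f * t * e).
have gi : is_idem g by rewrite /is_idem gE; word ts.
have fg : f * g = g by rewrite gE; word fi.
have ge : g * e = g by rewrite gE; word ei.
have egf : e * g * f = e * f by rewrite gE; word st.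
have eg : e * g = g.
  by apply: uni; rewrite /is_idem; word (ge, gi).
by rewrite -egf eg /is_idem; word (fg, gi).
Qed.

(** * Sandwich matrices through a base idempotent *)

(** All connecting elements between distinct idempotents pass through [z], along
    [q] and [r]; as these are inverse to each other, conjugation by them relates
    the idempotents at [e] with those at [z]. *)
Record factored (S : semigroupType) (p : sandwich S) (z : S) (q r : S -> S) :
    Prop := Factored {
  fact_zi : is_idem z;
  fact_q : forall e, is_idem e -> between e z (q e);
  fact_r : forall e, is_idem e -> between z e (r e);
  fact_qrq : forall e, is_idem e -> q e * r e * q e = q e;
  fact_rqr : forall e, is_idem e -> r e * q e * r e = r e;
  fact_p : forall e f, is_idem e -> is_idem f -> e != f -> p e f = q e * r f }.

Lemma factored_sandwich (S : semigroupType) : regular S ->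
  exists p : sandwich S, S -> exists z q r, factored p z q r.
Proof.
move=> reg; have [[s]|noS] := pselect (inhabited S); last first.
  have noS' : S -> False by move=> s; exact: noS.
  by exists (@Sandwich S (fun e f => e) (fun e => match noS' e with end)
    (fun e _ => erefl)) => s; case: noS.
have [z [_ [zi _ _ _]]] := regular_local_units reg s.
have /choice[t tP] : forall e, exists t, e * z * t * (e * z) = e * z.
  by move=> e; have [t [et _]] := regularP reg (e * z); exists t.
pose q e := e * z; pose r e := z * t e * e * z * t e * e.
have qb e : is_idem e -> between e z (q e).
  by move=> ei; split; rewrite /q; word (ei, zi).
have rb e : is_idem e -> between z e (r e).
  by move=> ei; split; rewrite /r; word (ei, zi).
pose p e f := if e == f then e else q e * r f.
have pb e f : is_idem e -> is_idem f -> between e f (p e f).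
  move=> ei fi; rewrite /p; case: eqP => [<- //|_].
  have [[eq _] [_ rf]] := (qb e ei, rb f fi).
  by split; [word eq | word rf].
have pe e : is_idem e -> p e e = e by rewrite /p eqxx.
exists (Sandwich pb pe) => _; exists z, q, r; split=> //.
- by move=> e ei; rewrite /q /r; have := tP e; rewrite !mulgA => et; word (et, ei, zi).
- by move=> e ei; rewrite /q /r; have := tP e; rewrite !mulgA => et; word (et, ei, zi).
- by move=> e f ei fi /negPf ef; rewrite /= /p ef.
Qed.

(** * Orthodox and L-unipotent consolidations *)

Section Orthodox.
Variables (S : semigroupType) (p : sandwich S) (z : S) (q r : S -> S).
Hypotheses (pF : factored p z q r) (loc : locally_has orthodox S).

Let zi : is_idem z := fact_zi pF.

Lemma fact_words (e : S) : is_idem e ->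
  [/\ [/\ e * q e = q e, q e * z = q e, z * r e = r e & r e * e = r e],
      q e * r e * q e = q e & r e * q e * r e = r e].
Proof.
move=> ei; have [eq qz] := fact_q pF ei; have [zr re] := fact_r pF ei.
by split; [split | exact: fact_qrq pF _ ei | exact: fact_rqr pF _ ei].
Qed.

Lemma fact_rq_idem (e : S) : is_idem e -> local_idem z (r e * q e).
Proof.
move=> ei; have [[eq qz zr re] qrq rqr] := fact_words ei.
by split; [split; [word zr | word qz] | rewrite /is_idem; word qrq].
Qed.

Lemma fact_qr_idem (e : S) : is_idem e -> local_idem e (q e * r e).
Proof.
move=> ei; have [[eq qz zr re] qrq rqr] := fact_words ei.
by split; [split; [word eq | word re] | rewrite /is_idem; word qrq].
Qed.

(** [q] and [r] carry local idempotents at [e] to local idempotents at [z], and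
    back, because the idempotents [q r] and [r q] multiply well with them. *)
Lemma conj_to_base (e x : S) : is_idem e -> local_idem e x ->
  local_idem z (r e * x * q e).
Proof.
move=> ei xl; have [[eq qz zr re] qrq rqr] := fact_words ei.
split; first by split; [word zr | word qz].
have [_] := local_idemM ei loc xl (fact_qr_idem ei).
rewrite /is_idem !mulgA => xqr.
transitivity (r e * (x * q e * r e * x * q e * r e) * q e); first by word qrq.
by rewrite xqr; word qrq.
Qed.

Lemma conj_from_base (e w : S) : is_idem e -> local_idem z w ->
  local_idem e (q e * w * r e).
Proof.
move=> ei wl; have [[eq qz zr re] qrq rqr] := fact_words ei.
split; first by split; [word eq | word re].
have [_] := local_idemM zi loc wl (fact_rq_idem ei).
rewrite /is_idem !mulgA => wrq.
transitivity (q e * (w * r e * q e * w * r e * q e) * r e); first by word rqr.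
by rewrite wrq; word rqr.
Qed.

(** The products of a local idempotent at [e] and of one at [f], distinct, have
    this form, with [w = z]. *)
Definition through_base (e f x : S) : Prop :=
  exists a w b, [/\ local_idem e a, local_idem z w, local_idem f b
    & x = a * q e * w * r f * b].

(** These elements form a subsemigroup of the consolidation; it turns out to
    be the set of idempotents. *)
Definition core (e f x : S) : Prop :=
  e = f /\ local_idem e x \/ through_base e f x.

Lemma local_idem_id (e : S) : is_idem e -> local_idem e e.
Proof. by []. Qed.

Lemma core_mul (e f g h x y : S) :
  is_idem e -> is_idem f -> is_idem g -> is_idem h ->
  core e f x -> core g h y -> core e h (x * p f g * y).
Proof.
move=> ei fi gi hi.
have zl := local_idem_id zi.
have pfg : (f = g /\ p f g = f) \/ p f g = q f * r g.
  have [<-|fg] := eqVneq f g; first by left; rewrite (sw_id p fi).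
  by right; rewrite (fact_p pF).
have [[fq qz zr rf] _ _] := fact_words fi.
have [[gq qz' zr' rg] _ _] := fact_words gi.
case=> [[ef xl]|[a [w [b [al wl bl ->]]]]] [[gh yl]|[a' [w' [b' [al' wl' bl' ->]]]]].
- subst h f; have [[_ xe] _] := xl.
  case: pfg => [[eg ->]|->]; [left; subst g | right].
    by split=> //; rewrite xe; exact: local_idemM.
  by exists x, z, y; split=> //; word qz.
- subst f; right; have [[_ xe] _] := xl.
  case: pfg => [[eg ->]|->]; [subst g|].
    by exists (x * a'), w', b'; split=> //; [exact: local_idemM | word xe].
  exists x, (r g * a' * q g * w'), b'; split=> //; last by rewrite !mulgA.
  by apply: local_idemM => //; exact: conj_to_base.
- subst h; right; have [[_ bf] _] := bl.
  case: pfg => [[fg ->]|->]; [subst g|].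
    by exists a, w, (b * y); split=> //; [exact: local_idemM | word bf].
  exists a, (w * (r f * b * q f)), y; split=> //; last by rewrite !mulgA.
  by apply: local_idemM => //; exact: conj_to_base.
- right; exists a, (w * (r f * b * p f g * a' * q g) * w'), b'.
  split=> //; last by rewrite !mulgA.
  apply: local_idemM => //; apply: local_idemM => //.
  case: pfg => [[fg ->]|->]; [subst g|].
    have -> : r f * b * f * a' * q f = r f * (b * a') * q f.
      by have [[_ bf] _] := bl; word bf.
    by apply: conj_to_base => //; exact: local_idemM.
  have -> : r f * b * (q f * r g) * a' * q g = r f * b * q f * (r g * a' * q g).
    by rewrite !mulgA.
  by apply: local_idemM => //; exact: conj_to_base.
Qed.

(** With [w = q_e r_e], this is [(a w) (a w) = a w], multiplied by [q_e]. *)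
Lemma conj_absorb_l (e a : S) : is_idem e -> local_idem e a ->
  a * q e * (r e * a * q e) = a * q e.
Proof.
move=> ei al; have [[eq qz zr re] qrq rqr] := fact_words ei.
have [_] := local_idemM ei loc al (fact_qr_idem ei).
rewrite /is_idem !mulgA => /(congr1 (fun u => u * q e)).
by word qrq.
Qed.

Lemma conj_absorb_r (e b : S) : is_idem e -> local_idem e b ->
  r e * b * q e * (r e * b) = r e * b.
Proof.
move=> ei bl; have [[eq qz zr re] qrq rqr] := fact_words ei.
have [_] := local_idemM ei loc (fact_qr_idem ei) bl.
rewrite /is_idem !mulgA => /(congr1 (fun u => r e * u)).
by word rqr.
Qed.

Lemma core_idem (e f x : S) : is_idem e -> is_idem f ->
  core e f x -> x * p f e * x = x.
Proof.
move=> ei fi [[<- [[ex xe] xi]]|[a [w [b [al wl bl ->]]]]].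
  by rewrite (sw_id p ei); word (xe, xi).
have [[ea ae] ai] := al; have [[fb bf] bi] := bl; have [[zw wz] wi] := wl.
have [ef|ef] := eqVneq f e.
  rewrite {}ef in fi fb bf bi bl *.
  have [[_ wb]] : local_idem e (a * (q e * w * r e) * b).
    by apply: local_idemM => //; apply: local_idemM => //; exact: conj_from_base.
  rewrite /is_idem !mulgA => xx; rewrite (sw_id p ei).
  by word bf; rewrite xx.
rewrite (fact_p pF) //.
have a'l := conj_to_base ei al; have b'l := conj_to_base fi bl.
have [a' a'E] : exists a', a' = r e * a * q e by exists (r e * a * q e).
have [b' b'E] : exists b', b' = r f * b * q f by exists (r f * b * q f).
have aa' : a * q e * a' = a * q e by rewrite a'E conj_absorb_l.
have b'b : b' * r f * b = r f * b by rewrite -(mulgA b') b'E conj_absorb_r.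
have [_] : local_idem z (a' * w * b').
  apply: local_idemM => //; last by rewrite b'E.
  by apply: local_idemM => //; rewrite a'E.
rewrite /is_idem !mulgA => awb.
transitivity (a * q e * (a' * w * b' * a' * w * b') * r f * b).
  by word (aa', b'b); rewrite b'E a'E !mulgA.
by rewrite awb; word (aa', b'b).
Qed.

(** With [w = r_e x q_f], [d = r_e q_e] and [d' = r_f q_f], the identity
    [x = (x q_f r_e) q_e r_f (q_f r_e x)] amounts to [w d d' w = w] in the band of
    idempotents of [z S z]. This holds because [d w = w = w d'] and [d' d] is
    idempotent. *)
Lemma idem_core (e f x : S) : is_idem e -> is_idem f -> between e f x ->
  x * p f e * x = x -> core e f x.
Proof.
move=> ei fi [ex xf]; have [ef|ef] := eqVneq f e.
  subst f; rewrite (sw_id p ei) xf => xi; left; split=> //; split=> //.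
rewrite (fact_p pF) // !mulgA => xx; right.
have [[eq ezq zre re] qrq rqr] := fact_words ei.
have [[fq qz zr rf] qrq' rqr'] := fact_words fi.
exists (x * q f * r e), z, (q f * r e * x); split=> //.
- by split; [split; [word ex | word re] | rewrite /is_idem; word xx].
- by split; [split; [word fq | word xf] | rewrite /is_idem; word xx].
have [w wE] : exists w, w = r e * x * q f by exists (r e * x * q f).
have wl : local_idem z w.
  rewrite wE; split; [split; [word zre | word qz] | rewrite /is_idem].
  by word xx.
have [_ wi] := wl.
have [d dE] : exists d, d = r e * q e by exists (r e * q e).
have [d' d'E] : exists d', d' = r f * q f by exists (r f * q f).
have dw : d * w = w by rewrite dE wE; word rqr.
have wd' : w * d' = w by rewrite d'E wE; word qrq'.
have [_] : local_idem z (d' * d).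
  by apply: local_idemM => //; [rewrite d'E | rewrite dE]; exact: fact_rq_idem.
rewrite /is_idem !mulgA => ddi.
have wdd : w * d * d' * w = w.
  transitivity (w * (d' * d * d' * d) * w); first by word (wd', dw).
  by rewrite ddi; word (wd', dw, eq_of_idem wi).
transitivity (x * q f * (w * d * d' * w) * r e * x).
  by rewrite wdd wE; word xx.
by rewrite wE dE d'E; word (xx, ezq).
Qed.

Lemma consolidation_orthodox : regular S -> orthodox (consolidation p).
Proof.
move=> reg; split=> [|a b]; first exact: cons_regular.
have coreP (c : consolidation p) : is_idem c -> core (src c) (tgt c) (elt c).
  move=> /cons_idemP cc; apply: idem_core cc; first exact: src_idem.
    exact: tgt_idem.
  by split; [exact: elt_src | exact: elt_tgt].
move=> /coreP ac /coreP bc; apply/cons_idemP; rewrite srcM tgtM eltM.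
by apply: core_idem; [exact: src_idem|exact: tgt_idem|apply: core_mul] => //;
  (exact: src_idem || exact: tgt_idem).
Qed.

End Orthodox.

Section LUnipotent.
Variables (S : semigroupType) (p : sandwich S) (z : S) (q r : S -> S).
Hypotheses (pF : factored p z q r) (loc : locally_has L_unipotent S).

(** [a b] and [b] are L-related idempotents. *)
Lemma L_unipotent_absorb (e a b : S) : is_idem e ->
  local_idem e a -> local_idem e b -> b * a = b -> a * b = b.
Proof.
move=> ei al bl ba; have [[ea ae] ai] := al; have [[eb be] bi] := bl.
apply: (locally_L_unipotent_eq ei loc) => //; last by word (ba, eq_of_idem bi).
  split; first by split; [word ea | word be].
  by rewrite /is_idem; word (ba, eq_of_idem bi).
by word (eq_of_idem bi, ba).
Qed.

(** L-unipotency makes [q_e r_e] a left unit of [x], and [r_f q_f] a left unit of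
    [r_e x]. In effect the idempotent [(e, x, f)] is locally equal to
    [(f, p_(f, e) x, f)], so that L-related idempotents can be compared in the
    local submonoid at [f]. *)
Lemma idem_locally_equal (g e f x : S) :
  is_idem g -> is_idem e -> is_idem f -> between e f x -> x * p f e * x = x ->
  p g e * x = p g f * (p f e * x).
Proof.
move=> gi ei fi [ex xf] xx; have [fe|fe] := eqVneq f e.
  by subst f; rewrite (sw_id p ei) ex.
have [[eq ezq zre re] qrq rqr] := fact_words pF ei.
have [[fq qz zr rf] qrq' rqr'] := fact_words pF fi.
have loc' : locally_has orthodox S := locally_has_mono L_unipotent_orthodox loc.
rewrite (fact_p pF fi ei fe) !mulgA in xx *.
have qrx : q e * r e * x = x.
  have xl : local_idem e (x * q f * r e).
    by split; [split; [word ex | word re] | rewrite /is_idem; word xx].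
  have := L_unipotent_absorb ei (fact_qr_idem pF ei) xl.
  move=> /(_ ltac:(word rqr)) /(congr1 (fun u => u * x)).
  by word xx.
have rqrx : r f * q f * r e * x = r e * x.
  have xl : local_idem z (r e * x * q f).
    split; [split; [word zre | word qz] | rewrite /is_idem].
    by word xx.
  have := L_unipotent_absorb (fact_zi pF) (fact_rq_idem pF fi) xl.
  move=> /(_ ltac:(word qrq')) /(congr1 (fun u => u * (r e * x))).
  by word xx.
have gx : p g e * x = q g * r e * x.
  have [ge|ge] := eqVneq g e; last by rewrite (fact_p pF).
  by subst g; rewrite (sw_id p ei) ex qrx.
rewrite gx; have [gf|gf] := eqVneq g f.
  by subst g; rewrite (sw_id p fi); word fq.
by rewrite (fact_p pF) //; word rqrx.
Qed.

Lemma lcls_local_idem (a : consolidation p) : is_idem a ->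
  exists2 b : consolidation p, lcls a = lcls b &
  [/\ src b = tgt a, tgt b = tgt a & elt b = p (tgt a) (src a) * elt a].
Proof.
move=> /cons_idemP ai.
have bb : between (tgt a) (tgt a) (p (tgt a) (src a) * elt a).
  by split; [word (sw_l a a) | rewrite -mulgA elt_tgt].
exists (mkCons p (tgt_idem a) (tgt_idem a) bb) => //.
apply/lclsP => x y; apply: cons_eq => //; rewrite !eltM !tgtM /src /tgt /elt /=.
rewrite -/(src a) -/(tgt a) -/(elt a) -/(elt x) -/(elt y) -/(src y) -/(tgt x).
rewrite -(mulgA (elt x)) (idem_locally_equal (tgt_idem x) (src_idem a) (tgt_idem a)) //.
  by rewrite !mulgA.
by split; [exact: elt_src | exact: elt_tgt].
Qed.

Lemma L_related_locally_equal (a c : consolidation p) :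
  is_idem a -> is_idem c -> a * c = a -> c * a = c -> lcls a = lcls c.
Proof.
move=> ai ci ac ca; have fi := tgt_idem a.
have tac : tgt a = tgt c by rewrite -ac.
have [b -> [sb tb eb]] := lcls_local_idem ai.
have [d -> [sd td ed]] := lcls_local_idem ci.
suff be : elt b = elt d by congr lcls; apply: cons_eq; rewrite // ?sb ?sd ?tb ?td.
move/cons_idemP: ai => ai; move/cons_idemP: ci => ci.
have {}ac := congr1 (@elt S p) ac; have {}ca := congr1 (@elt S p) ca.
rewrite !eltM in ac ca; rewrite eb ed -tac in ca ci *.
have pl (t : consolidation p) : tgt t = tgt a ->
    elt t * p (tgt a) (src t) * elt t = elt t ->
    local_idem (tgt a) (p (tgt a) (src t) * elt t).
  move=> ta tt; split; last by rewrite /is_idem; word tt.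
  by split; [rewrite -ta; word (sw_l t t) | rewrite -mulgA -ta elt_tgt].
apply: (locally_L_unipotent_eq fi loc); first exact: pl.
- exact: pl.
- by word ac.
- by word ca.
Qed.

Lemma local_quotient_L_unipotent : regular S ->
  L_unipotent (local_quotient (consolidation p)).
Proof.
move=> reg; have loc' := locally_has_mono L_unipotent_orthodox loc.
have [regT idM] := consolidation_orthodox pF loc' reg.
apply/L_unipotentP; split; first exact: local_quotient_regular.
move=> u v /lcls_idem_lift[a ai ->] /lcls_idem_lift[c ci ->] ac ca.
(* [a] and [c] are L-related only up to local equality; [a c] and [c a c] are
   L-related. *)
have aci := idM _ _ ai ci; have caci := idM _ _ ci aci.
rewrite -lclsM in ac; rewrite -lclsM in ca.
have -> : lcls c = lcls (c * (a * c)).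
  by rewrite mulgA (lclsM (c * a)) ca -(lclsM c) ci.
rewrite -ac; apply: L_related_locally_equal => //.
  by word ci; rewrite -[RHS]aci mulgA.
by rewrite -mulgA aci.
Qed.

End LUnipotent.

(** * Inverse semigroups and semilattices *)

Section Normal.
Variable T : semigroupType.
Hypotheses (idM : forall e f : T, is_idem e -> is_idem f -> is_idem (e * f))
  (com : forall e x y : T, is_idem e -> local_idem e x -> local_idem e y ->
     x * y = y * x).

(** The J-classes of a band are rectangular, and the J-class of [a] lies below
    that of [b]. *)
Lemma band_absorb (a s b t : T) : is_idem b -> is_idem t -> is_idem a ->
  a = s * b * t -> a * b * a = a.
Proof.
move=> bi ti ai aE.
have bti : b * t * b * t = b * t by have := idM bi ti; rewrite /is_idem !mulgA.
have abi : a * b * a * b = a * b by have := idM ai bi; rewrite /is_idem !mulgA.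
have act : a * b * t = a by rewrite aE; word bti.
transitivity (a * b * a * b * t * a); first by word (act, eq_of_idem ai).
by rewrite abi act; exact: ai.
Qed.

(** [band_absorb] for [u v], which is again in the ideal of [b]. *)
Lemma band_absorb_step (s b t u v : T) :
  is_idem b -> is_idem t -> is_idem u -> is_idem v -> u = s * b * t ->
  u * v * u = u -> u * v * b * u = u.
Proof.
move=> bi ti ui vi uE uvu.
have uvE : u * v = s * b * (t * v) by rewrite uE !mulgA.
have := band_absorb bi (idM ti vi) (idM ui vi) uvE.
by move=> /(congr1 (fun w => w * u)); rewrite !mulgA; word uvu.
Qed.

Lemma band_absorb4 (e a b h : T) :
  is_idem e -> is_idem a -> is_idem b -> is_idem h ->
  e * a * b * h * (e * b * a * h) * (e * a * b * h) = e * a * b * h.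
Proof.
move=> ei ai bi hi; have [m mE] : exists m, m = e * a * b * h by exists (e * a * b * h).
have [abi bhi] := (idM ai bi, idM bi hi); have abhi := idM abi hi.
have eb := idM ei bi; have eba := idM eb ai.
have mi : is_idem m
  by rewrite mE; apply: idM => //; apply: idM => //; exact: idM.
have mem : m * e * m = m.
  by apply: (@band_absorb m e e (a * b * h)); rewrite // mE ei !mulgA.
have := band_absorb_step (s := e * a) (b := b) (t := h) bi hi mi ei mE mem.
rewrite -(mulgA m) => /(band_absorb_step (s := e) (b := a) (t := b * h) ai bhi mi eb).
move=> /(_ ltac:(by rewrite mE !mulgA)).
rewrite -(mulgA m) => /(band_absorb_step (s := e * a * b) (b := h) (t := h) hi hi mi eba).
move=> /(_ ltac:(by rewrite mE; word (eq_of_idem hi))).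
by rewrite -(mulgA m) mE.
Qed.

(** The idempotents form a normal band: [m = e a b h] and [n = e b a h] satisfy
    [m n m = m] and [n m n = n], while [m n e = n m e] and [h m n = h n m] because
    idempotents commute below [e] and below [h]. *)
Lemma normal_band (e a b h : T) :
  is_idem e -> is_idem a -> is_idem b -> is_idem h ->
  e * a * b * h = e * b * a * h.
Proof.
move=> ei ai bi hi.
have := band_absorb4 ei ai bi hi; have := band_absorb4 ei bi ai hi.
have mni x y : is_idem x -> is_idem y -> is_idem (e * x * y * h).
  by move=> xi yi; apply: idM => //; apply: idM => //; exact: idM.
have := mni _ _ ai bi; have := mni _ _ bi ai.
have : e * (e * a * b * h) = e * a * b * h by word ei.
have : e * (e * b * a * h) = e * b * a * h by word ei.
have : (e * a * b * h) * h = e * a * b * h by word hi.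
have : (e * b * a * h) * h = e * b * a * h by word hi.
move: (e * a * b * h) (e * b * a * h) => m n nh mh en em ni mi nmn mnm.
have mne : m * n * e = n * m * e.
  have loc x : e * x = x -> is_idem x -> local_idem e (x * e).
    move=> ex xi; split; last exact: idM.
    by split; [rewrite mulgA ex | rewrite -mulgA ei].
  by have := com ei (loc m em mi) (loc n en ni); word (em, en).
have hmn : h * m * n = h * n * m.
  have loc x : x * h = x -> is_idem x -> local_idem h (h * x).
    move=> xh xi; split; last exact: idM.
    by split; [rewrite mulgA hi | rewrite -mulgA xh].
  by have := com hi (loc m mh mi) (loc n nh ni); word (mh, nh).
have -> : m = n * m.
  by have := congr1 (fun w => w * m) mne; word (em, mnm, eq_of_idem mi).
by have := congr1 (fun w => n * w) hmn; word (nh, nmn, eq_of_idem ni).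
Qed.

Lemma local_quotient_idem_comm : regular T ->
  idempotents_commute (local_quotient T).
Proof.
move=> reg u v /lcls_idem_lift[a ai ->] /lcls_idem_lift[b bi ->].
rewrite -!lclsM; apply: lcls_eq_idem => // e h ei hi.
by rewrite !mulgA; exact: normal_band.
Qed.

End Normal.

Section LocallyCommuting.
Variables (S : semigroupType) (p : sandwich S).
Hypothesis loc : forall e x y : S, is_idem e -> local_idem e x ->
  local_idem e y -> x * y = y * x.

Lemma consolidation_locally_comm (a b c : consolidation p) :
  is_idem a -> local_idem a b -> local_idem a c -> b * c = c * b.
Proof.
move=> ai.
have abs (d : consolidation p) : local_idem a d ->
    [/\ src d = src a, tgt d = tgt a &
     [/\ elt d * p (tgt a) (src a) * elt d = elt d,
         elt d * p (tgt a) (src a) * elt a = elt d &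
         local_idem (src a) (elt d * p (tgt a) (src a))]].
  move=> [[ad da] di]; have sd : src d = src a by rewrite -ad.
  have td : tgt d = tgt a by rewrite -da.
  have dd := congr1 (@elt S p) di; have {}da := congr1 (@elt S p) da.
  rewrite !eltM sd td in dd da.
  split=> //; split=> //; split; last by rewrite /is_idem; word dd.
  by split; [rewrite !mulgA -{1}sd elt_src | rewrite -mulgA sw_r].
move=> /abs[sb tb [bb ba bl]] /abs[sc tc [cc ca cl]].
apply: cons_eq; rewrite ?srcM ?tgtM ?sb ?sc ?tb ?tc // !eltM sb sc tb tc.
rewrite -{1}ca -{2}ba !mulgA.
by have := loc (src_idem a) bl cl; rewrite !mulgA => ->.
Qed.

End LocallyCommuting.

(** * E-solid consolidations *)

Section ESolid.
Variable S : semigroupType.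
Hypotheses (reg : regular S) (loc : locally_has E_solid S).

(** [c] is the idempotent common to the L-class of [v] and the R-class of [u]. *)
Lemma hits_idem (v u : S) : hits v u -> exists c w w',
  [/\ is_idem c, v * c = v, c * u = u, c = u * w & c = w' * v].
Proof.
move=> [s [t [vus tvu]]]; have [w [] ] := regularP reg (v * u).
rewrite !mulgA => vuw wvu; exists (u * w * v), (w * v), (u * w).
split; rewrite ?mulgA // /is_idem.
- by word wvu.
- transitivity (v * u * w * v * u * s); first by word vus.
  by rewrite vuw vus.
- transitivity (t * v * u * w * v * u); first by rewrite tvu.
  by word (tvu, vuw).
Qed.

(** As a relation between rows, the elements of [S e], and columns, the elements of
    [e S], hitting is difunctional: idempotents [c] and [a] replace the pairs
    [(v1, u1)] and [(v2, u2)], and [hits v2 u1] becomes [hits a c]. *)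
Lemma hits_difunctional (e v1 v2 u1 u2 : S) : is_idem e ->
  v1 * e = v1 -> v2 * e = v2 -> e * u1 = u1 -> e * u2 = u2 ->
  hits v1 u1 -> hits v2 u1 -> hits v2 u2 -> hits v1 u2.
Proof.
move=> ei v1e v2e eu1 eu2 /hits_idem[c [w1 [w1' [ci v1c cu1 cE cE']]]].
move=> [x [y [vux yvu]]] /hits_idem[a [w2 [w2' [ai v2a au2 aE aE']]]].
have cl : local_idem e c.
  by split=> //; split; [rewrite cE mulgA eu1 | rewrite cE' -mulgA v1e].
have al : local_idem e a.
  by split=> //; split; [rewrite aE mulgA eu2 | rewrite aE' -mulgA v2e].
have [s [t [cas tca]]] : hits c a.
  apply: (locally_E_solid_hits ei loc al cl); exists (u1 * x), (y * v2); split.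
    by word cu1; rewrite aE'; word vux.
  by word v2a; rewrite cE; word yvu.
exists (w2 * s), (t * w1'); split.
  transitivity (v1 * (c * a * s)); last by rewrite cas.
  by word v1c; rewrite aE !mulgA.
transitivity (t * c * a * u2); first by word au2; rewrite cE' !mulgA.
by rewrite tca.
Qed.

(** The same notion across a connecting element [m]. *)
Definition hits_through (m v u : S) : Prop :=
  exists s t, v * m * u * s = v /\ t * v * m * u = u.

Variables (p : sandwich S) (z : S) (q r : S -> S).
Hypothesis pF : factored p z q r.

Definition extends_l (f v : S) : Prop := exists s, v * q f * s = v.

Definition extends_r (e u : S) : Prop := exists t, t * r e * u = u.

Lemma hits_through_extends (f e v u : S) : hits_through (q f * r e) v u ->
  extends_l f v /\ extends_r e u.
Proof.
move=> [s [t [vs ut]]]; split; first by exists (r e * u * s); rewrite !mulgA in vs *.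
by exists (t * v * q f); rewrite !mulgA in ut *.
Qed.

(** Difunctionality is used with the rows [v] and [v q r], and with the column
    [m = q r u s v'], which both rows hit since [v m = v q r m = v v']. *)
Lemma hits_of_through (e v u : S) : is_idem e -> v * e = v -> e * u = u ->
  hits_through (q e * r e) v u -> hits v u.
Proof.
move=> ei ve eu [s [t [vs ut]]]; rewrite !mulgA in vs ut.
have [[eq qz zr re] qrq rqr] := fact_words pF ei.
have [v' [vv v'v]] := regularP reg v.
apply: (@hits_difunctional e v (v * q e * r e) (q e * r e * u * s * v') u) => //.
- by word re.
- by word eq.
- by exists v, (q e * r e * u * s * v'); split; word (vs, vv, v'v).
- exists (v * q e * r e), (q e * r e * u * s * v'); split; word (qrq, vs, vv, v'v).
- by exists (s * q e * r e), t; split; word (vs, ut).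
Qed.

(** Here the column [m = q s v'] is hit by the rows [v] and [v q r]. *)
Lemma through_of_extends_l (e v u : S) : is_idem e -> v * e = v -> e * u = u ->
  hits v u -> extends_l e v -> hits_through (q e * r e) v u.
Proof.
move=> ei ve eu vu [s vs].
have [[eq qz zr re] qrq rqr] := fact_words pF ei.
have [v' [vv v'v]] := regularP reg v.
have [s1 [t1 [vs1 ut1]]] : hits (v * q e * r e) u.
  apply: (@hits_difunctional e _ v (q e * s * v') u) => //.
  - by word re.
  - by word eq.
  - by exists (v * q e * r e), (q e * s * v'); split; word (qrq, vs, vv, v'v).
  - by exists v, (q e * s * v'); split; word (vs, vv, v'v).
rewrite !mulgA in vs1 ut1.
by exists (s1 * q e * s), t1; rewrite !mulgA vs1; split=> //; word (qrq, vs).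
Qed.

(** Dually, the row [u' t r] hits the columns [u] and [q r u]. *)
Lemma through_of_extends_r (e v u : S) : is_idem e -> v * e = v -> e * u = u ->
  hits v u -> extends_r e u -> hits_through (q e * r e) v u.
Proof.
move=> ei ve eu vu [t ut].
have [[eq qz zr re] qrq rqr] := fact_words pF ei.
have [u' [uu u'u]] := regularP reg u.
have [s1 [t1 [vs1 ut1]]] : hits v (q e * r e * u).
  apply: (@hits_difunctional e v (u' * t * r e) u _) => //.
  - by word re.
  - by word eq.
  - by exists (u' * t * r e), u; split; word (ut, uu, u'u).
  - by exists (u' * t * r e), (q e * r e * u); split; word (rqr, ut, uu, u'u).
rewrite !mulgA in vs1 ut1.
exists s1, (t * r e * t1); rewrite !mulgA vs1; split=> //.
transitivity (t * r e * (t1 * v * q e * r e * u)); first by rewrite !mulgA.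
by rewrite ut1; word (rqr, ut).
Qed.

(** This is difunctionality at [z], for the rows [v q] and the columns [r u]. *)
Lemma hits_through_difunctional (f1 f2 e1 e2 v1 v2 u1 u2 : S) :
  is_idem f1 -> is_idem f2 -> is_idem e1 -> is_idem e2 ->
  hits_through (q f1 * r e1) v1 u1 -> hits_through (q f2 * r e1) v2 u1 ->
  hits_through (q f2 * r e2) v2 u2 -> hits_through (q f1 * r e2) v1 u2.
Proof.
move=> f1i f2i e1i e2i H11 H21 H22.
have base f e v u : hits_through (q f * r e) v u -> hits (v * q f) (r e * u).
  move=> [s [t [vs ut]]]; exists (s * q f), (r e * t); rewrite !mulgA in vs ut *.
  by rewrite vs; split=> //; word ut.
have [[s vs] _] := hits_through_extends H11.
have [_ [t ut]] := hits_through_extends H22.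
have [[_ q1z _ _] _ _] := fact_words pF f1i.
have [[_ q2z _ _] _ _] := fact_words pF f2i.
have [[_ _ zr1 _] _ _] := fact_words pF e1i.
have [[_ _ zr2 _] _ _] := fact_words pF e2i.
have [s1 [t1 [vs1 ut1]]] : hits (v1 * q f1) (r e2 * u2).
  apply: (hits_difunctional (fact_zi pF) _ _ _ _ (base _ _ _ _ H11)
    (base _ _ _ _ H21) (base _ _ _ _ H22)); rewrite ?mulgA ?zr1 ?zr2 //.
    by rewrite -mulgA q1z.
  by rewrite -mulgA q2z.
rewrite !mulgA in vs1 ut1; exists (s1 * s), (t * t1); rewrite !mulgA vs1.
split=> //; transitivity (t * (t1 * v1 * q f1 * r e2 * u2)); first by rewrite !mulgA.
by rewrite ut1 !mulgA.
Qed.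

Lemma hits_through_id (e v u : S) : v * e = v -> hits_through e v u <-> hits v u.
Proof.
move=> ve; split=> [[s [t [vs ut]]]|[s [t [vs ut]]]]; exists s, t;
  by move: vs ut; rewrite -!(mulgA t) ve.
Qed.

Lemma sandwich_through (f e v u : S) : is_idem f -> is_idem e ->
  v * f = v -> e * u = u -> hits_through (p f e) v u ->
  [\/ f != e, extends_l f v | extends_r e u] -> hits_through (q f * r e) v u.
Proof.
move=> fi ei vf eu; have [fe|fe] := eqVneq f e; last by rewrite (fact_p pF).
subst e; rewrite (sw_id p fi) hits_through_id // => vu.
by case=> // [|]; [exact: through_of_extends_l | exact: through_of_extends_r].
Qed.

(** If two of the objects differ, the corresponding pair goes through the base,
    and this propagates to the three pairs. *)
Lemma sandwich_difunctional (f1 f2 e1 e2 v1 v2 u1 u2 : S) :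
  is_idem f1 -> is_idem f2 -> is_idem e1 -> is_idem e2 ->
  v1 * f1 = v1 -> v2 * f2 = v2 -> e1 * u1 = u1 -> e2 * u2 = u2 ->
  hits_through (p f1 e1) v1 u1 -> hits_through (p f2 e1) v2 u1 ->
  hits_through (p f2 e2) v2 u2 -> hits_through (p f1 e2) v1 u2.
Proof.
move=> f1i f2i e1i e2i vf1 vf2 eu1 eu2 H11 H21 H22.
have T11 := sandwich_through f1i e1i vf1 eu1 H11.
have T21 := sandwich_through f2i e1i vf2 eu1 H21.
have T22 := sandwich_through f2i e2i vf2 eu2 H22.
have conclude : hits_through (q f1 * r e1) v1 u1 ->
    hits_through (q f2 * r e1) v2 u1 -> hits_through (q f2 * r e2) v2 u2 ->
    hits_through (p f1 e2) v1 u2.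
  move=> G11 G21 G22; have G12 := hits_through_difunctional f1i f2i e1i e2i G11 G21 G22.
  have [fe|fe] := eqVneq f1 e2; last by rewrite (fact_p pF).
  subst e2; rewrite (sw_id p f1i) hits_through_id //; exact: hits_of_through G12.
have [ef1|ne] := eqVneq f1 e1; last first.
  have G11 := T11 (Or31 _ _ ne); have [_ x1] := hits_through_extends G11.
  have G21 := T21 (Or33 _ _ x1); have [x2 _] := hits_through_extends G21.
  exact: conclude G11 G21 (T22 (Or32 _ _ x2)).
have [ef2|ne] := eqVneq f2 e1; last first.
  have G21 := T21 (Or31 _ _ ne); have [x2 x1] := hits_through_extends G21.
  exact: conclude (T11 (Or33 _ _ x1)) G21 (T22 (Or32 _ _ x2)).
have [ef3|ne] := eqVneq f2 e2; last first.
  have G22 := T22 (Or31 _ _ ne); have [x2 _] := hits_through_extends G22.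
  have G21 := T21 (Or32 _ _ x2); have [_ x1] := hits_through_extends G21.
  exact: conclude (T11 (Or33 _ _ x1)) G21 G22.
subst f1 f2 e2; rewrite (sw_id p e1i) !hits_through_id // in H11 H21 H22 *.
exact: (hits_difunctional e1i vf1 vf2 eu1 eu2 H11 H21 H22).
Qed.

Lemma consolidation_hitsP (a c : consolidation p) :
  hits a c <-> hits_through (p (tgt a) (src c)) (elt a) (elt c).
Proof.
split=> [[s [t [/(congr1 (@elt S p)) acs /(congr1 (@elt S p)) tac]]]|[s [t [acs tac]]]].
  rewrite !eltM in acs tac.
  exists (p (tgt c) (src s) * elt s), (elt t * p (tgt t) (src a)).
  by rewrite !mulgA in acs tac *.
have sb : between (tgt c) (tgt a) (tgt c * s * tgt a).
  by split; [word (tgt_idem c) | rewrite -mulgA tgt_idem].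
have tb : between (src c) (src a) (src c * t * src a).
  by split; [word (src_idem c) | rewrite -mulgA src_idem].
exists (mkCons p (tgt_idem c) (tgt_idem a) sb), (mkCons p (src_idem c) (src_idem a) tb).
split; apply: cons_eq => //; rewrite !eltM /src /elt /tgt /= -/(src c) -/(tgt c)
  -/(src a) -/(tgt a) -/(elt a) -/(elt c).
  rewrite (sw_id p (tgt_idem c)).
  by word (tgt_idem c, elt_tgt c); rewrite acs elt_tgt.
rewrite (sw_id p (src_idem a)).
by word (src_idem a, elt_src a, elt_src c, tac).
Qed.

Lemma consolidation_E_solid : E_solid (consolidation p).
Proof.
apply/E_solidP; split; first exact: cons_regular.
move=> a c ai ci /consolidation_hitsP ac; apply/consolidation_hitsP.
have self (b : consolidation p) : is_idem b ->
    hits_through (p (tgt b) (src b)) (elt b) (elt b).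
  move=> bi; apply/consolidation_hitsP; exists b, b.
  by rewrite /is_idem in bi; rewrite !bi.
apply: sandwich_difunctional (self c ci) ac (self a ai);
  by [exact: tgt_idem | exact: src_idem | exact: elt_tgt | exact: elt_src].
Qed.

End ESolid.

(** * Unions of groups *)

(** If [a = a a s = t a a], then [t a = a s] is an idempotent that is an identity
    for [a], and [t a s] is an inverse of [a] for it. *)
Lemma union_of_groups_of_squares (T : semigroupType) :
  (forall a : T, exists s t, a = a * a * s /\ a = t * (a * a)) ->
  union_of_groups T.
Proof.
move=> sq; apply/union_of_groupsP => a; have [s [t [/esym as_ /esym ta]]] := sq a.
rewrite !mulgA in ta; exists (t * a * s).
have tas : t * a = a * s.
  transitivity (t * (a * a * s)); first by rewrite as_.
  by word ta.
have asa : a * s * a = a by rewrite -tas ta.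
split; first by word (asa, as_, tas).
by word (tas, asa); word (as_, tas).
Qed.

Section JMeet.
Variables (S : semigroupType) (p : sandwich S).
Hypotheses (reg : regular S) (loc : locally_has union_of_groups S).

(** With [g = f x' x] and [x = s q t], the element [c = q t g] of the local
    submonoid at [f] satisfies [g = (f x' s) c]. As [c] lies in a subgroup, with
    identity [c d], this gives [g c d = g], so that [x = x g c d] is in [x q S]. *)
Lemma divides_r (e f x q : S) : is_idem f -> between e f x -> between f e q ->
  jle x q -> exists m, x * q * m = x.
Proof.
move=> fi [ex xf] [fq qe] [s [t xE]].
have [x' [xx _]] := regularP reg x.
have [g gE] : exists g, g = f * x' * x by exists (f * x' * x).
have xg : x * g = x by rewrite gE; word (xf, xx).
have fg : f * g = g by rewrite gE; word fi.
have gf : g * f = g by rewrite gE; word xf.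
have gg : g * g = g by rewrite {1}gE; word xg; rewrite gE.
have [c cE] : exists c, c = q * t * g by exists (q * t * g).
have cb : between f f c by rewrite cE; split; [word fq | word gf].
have [d [_ cdc cd]] := locally_union_of_groups_inv fi loc cb.
have gc : f * x' * s * c = g.
  transitivity (f * x' * (s * q * t) * g); first by rewrite cE !mulgA.
  by rewrite -xE -gE.
exists (t * g * d); transitivity (x * (g * (c * d))).
  by rewrite cE; word xg.
transitivity (x * (f * x' * s * (c * d * c))); last by rewrite cdc gc.
by rewrite -{1}gc; word cd.
Qed.

(** Dually, with [g = x x' e] and [c = g s q]. *)
Lemma divides_l (e f x q : S) : is_idem e -> between e f x -> between f e q ->
  jle x q -> exists m, m * q * x = x.
Proof.
move=> ei [ex xf] [fq qe] [s [t xE]].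
have [x' [xx _]] := regularP reg x.
have [g gE] : exists g, g = x * x' * e by exists (x * x' * e).
have gx : g * x = x by rewrite gE; word (ex, xx).
have ge : g * e = g by rewrite gE; word ei.
have eg : e * g = g by rewrite gE; word ex.
have gg : g * g = g by rewrite {2}gE; word gx; rewrite gE.
have [c cE] : exists c, c = g * s * q by exists (g * s * q).
have cb : between e e c by rewrite cE; split; [word eg | word qe].
have [d [_ cdc cd]] := locally_union_of_groups_inv ei loc cb.
have gc : c * (t * x' * e) = g.
  transitivity (g * (s * q * t) * (x' * e)); first by rewrite cE !mulgA.
  by rewrite -xE !mulgA gx -gE.
exists (d * g * s); transitivity (d * c * g * x).
  by rewrite cE; word gx.
transitivity (c * d * c * (t * x' * e) * x); last by rewrite cdc gc.
by rewrite -[in LHS]gc cd !mulgA.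
Qed.

Hypothesis pmeet : forall e f w, is_idem e -> is_idem f ->
  jle w e -> jle w f -> jle w (p e f).

Lemma between_jle (e f x : S) : is_idem e -> is_idem f -> between e f x ->
  jle x (p f e).
Proof.
move=> ei fi [ex xf]; apply: pmeet => //; first by exists x, f; word xf.
by exists e, x; word (ei, ex).
Qed.

(** As [x] is in [x p S], and [x p] is in a subgroup, [x] is in [x p x p S]; so it
    is in [x p x S], and dually in [S x p x]. *)
Lemma consolidation_union_of_groups : union_of_groups (consolidation p).
Proof.
apply: union_of_groups_of_squares => a.
have [ei fi] := (src_idem a, tgt_idem a).
have xb : between (src a) (tgt a) (elt a) by split; [exact: elt_src | exact: elt_tgt].
have qb := sw_between p fi ei; have xq := between_jle ei fi xb.
have [m xqm] := divides_r fi xb qb xq; have [n nqx] := divides_l ei xb qb xq.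
move: xb qb => [ex xf] [fq qe].
set x := elt a in ex xf xqm nqx *; set e := src a in ei ex qe fq xqm nqx *.
set f := tgt a in fi xf fq qe xqm nqx *; set q := p f e in fq qe xqm nqx *.
have xqb : between e e (x * q) by split; [word ex | word qe].
have qxb : between f f (q * x) by split; [word fq | word xf].
have [y [_ xyx xy]] := locally_union_of_groups_inv ei loc xqb.
have [y' [_ xyx' xy']] := locally_union_of_groups_inv fi loc qxb.
rewrite !mulgA in xyx xy xyx' xy'.
have sb : between f f (f * (q * y * m) * f) by split; word fi.
have tb : between e e (e * (n * y' * q) * e) by split; word ei.
exists (mkCons p fi fi sb), (mkCons p ei ei tb).
split; apply: cons_eq => //; rewrite !eltM ?tgtM ?srcM /src /elt /tgt /=
  -/(elt a) -/(src a) -/(tgt a) -/x -/e -/f -/q.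
  rewrite (sw_id p fi); word (fi, xf); rewrite -/f.
  transitivity (x * q * (x * q * y) * m * f).
    by rewrite xy; word (xqm, xf, xyx).
  by rewrite !mulgA.
rewrite (sw_id p ei); word (ei, ex).
transitivity (e * n * (y' * q * x) * q * x); last by rewrite !mulgA.
by rewrite -xy'; word (nqx, ex, xyx').
Qed.

End JMeet.

(** If [c = s e t = s' f t'] generates the meet of the ideals of [e] and [f], then
    so does [e t c' s' f], where [c = c c' c]: it is in the ideals of [e] and [f],
    and [c = s (e t c' s' f) t']. *)
Lemma meet_sandwich (S : semigroupType) : regular S ->
  (forall x y : S, exists z, jmeet x y z) ->
  exists p : sandwich S, forall e f w, is_idem e -> is_idem f ->
    jle w e -> jle w f -> jle w (p e f).
Proof.
move=> reg meet.
have /choice[p0 p0P] : forall ef : S * S, exists y, is_idem ef.1 -> is_idem ef.2 ->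
    [/\ between ef.1 ef.2 y, ef.1 = ef.2 -> y = ef.1 &
     forall w, jle w ef.1 -> jle w ef.2 -> jle w y].
  move=> [e f] /=; have [<-|ef] := pselect (e = f).
    by exists e => ei _; split.
  have [c [[s [t cE]] [s' [t' cE']] cw]] := meet e f.
  have [c' [cc _]] := regularP reg c.
  exists (e * t * c' * s' * f) => ei fi; split=> //.
    by split; [word ei | word fi].
  move=> w we wf; apply: jle_trans (cw w we wf) _; exists s, t'.
  transitivity (c * c' * c); first by rewrite cc.
  by rewrite {1}cE cE' !mulgA.
have pb e f : is_idem e -> is_idem f -> between e f (p0 (e, f)).
  by move=> ei fi; have [] := p0P (e, f) ei fi.
have p1 e : is_idem e -> p0 (e, e) = e.
  by move=> ei; have [_ ->] := p0P (e, e) ei ei.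
exists (@Sandwich S (fun e f => p0 (e, f)) pb p1) => e f w ei fi.
by have [_ _] := p0P (e, f) ei fi; apply.
Qed.

(** * Completely simple semigroups *)

(** A group has a single idempotent, so all idempotents of [S] are isomorphic, and
    none lies strictly below another. *)
Lemma completely_simple_of_group (S : semigroupType) (G : groupType) :
  morita_equivalent S G -> completely_simple S.
Proof.
move=> mor; have [hS _ _] := mor; have [K hK] := Karoubi_of_morita mor.
have regG : regular G.
  by apply: regular_of_inner => s; exists s^-1; rewrite mulgV mul1g.
have regS := regular_of_Karoubi hS hK regG.
have idem1 (g : G) : is_idem g -> g = 1.
  by rewrite /is_idem => gg; apply: (mulgI g); rewrite mulg1.
have iso (e f : Karoubi S) : isomorphic e f.
  apply: (isomorphic_reflect hK); apply/isomorphic_KaroubiP; exists 1, 1.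
  by rewrite !(idem1 _ (idemE _)) mulg1.
split=> [I [[x Ix] ideal]|].
  have [x' [xx _]] := regularP regS x.
  have ei : is_idem (x * x') by rewrite /is_idem; word xx.
  have Ie : I (x * x') by have [] := ideal x' x Ix.
  apply/seteqP; split=> // s _; have [f [_ [fi _ fs _]]] := hS s.
  have /isomorphic_KaroubiP /= [u [v [fu ue uv vu]]] := iso (mkIdem fi) (mkIdem ei).
  have Iu : I u by rewrite -ue; have [] := ideal u _ Ie.
  have If : I f by rewrite -uv; have [] := ideal v _ Iu.
  by rewrite -fs; have [] := ideal s _ If.
have idG : is_idem (1 : G) by rewrite /is_idem mulg1.
have [_ _ /(_ (mkIdem idG))[e _]] := hK.
exists (val e); split=> [|f fi ef fe]; first exact: idemE.
have [g gk] := Karoubi_embedding e hK; have gi := corner_embedding_idem gk.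
have lf : local_idem (val e) f by split=> //; split; rewrite -?ef -?fe.
have le : local_idem (val e) (val e) by split; [split; exact: idemE | exact: idemE].
have [m mi <-] := local_idem_lift (idemE e) lf.
have [n ni nE] := local_idem_lift (idemE e) le; rewrite -[RHS]nE.
have [_ gI _ _ _] := gk; congr val; apply: gI.
have gm : g m = 1 by apply/idem1/gi.
have gn : g n = 1 by apply/idem1/gi.
by rewrite gm gn.
Qed.

Section CornerFunctor.
Variables (M S : semigroupType) (f : M -> S) (k : S).
Hypothesis fk : corner_embedding f k.

Lemma corner_obj_subproof (e : Karoubi M) : is_idem (f (val e)).
Proof. by apply/(corner_embedding_idem fk); exact: idemE. Qed.

Definition corner_obj (e : Karoubi M) : Karoubi S := mkIdem (corner_obj_subproof e).

Lemma corner_hom_l (d e : Karoubi M) (s : hom d e) :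
  val (corner_obj d) * f (val s) = f (val s).
Proof. by have [fM _ _ _ _] := fk; rewrite /= -fM corner_l. Qed.

Lemma corner_hom_r (d e : Karoubi M) (s : hom d e) :
  f (val s) * val (corner_obj e) = f (val s).
Proof. by have [fM _ _ _ _] := fk; rewrite /= -fM corner_r. Qed.

Definition corner_hom (d e : Karoubi M) (s : hom d e) :
    @hom (Karoubi S) (corner_obj d) (corner_obj e) :=
  mkCorner (corner_hom_l s) (corner_hom_r s).

Lemma corner_fmap1 (e : Karoubi M) : corner_hom (idm e) = idm (corner_obj e).
Proof. exact: val_inj. Qed.

Lemma corner_fmapM (d e g : Karoubi M) (t : hom e g) (s : hom d e) :
  corner_hom (compm t s) = compm (corner_hom t) (corner_hom s).
Proof. by have [fM _ _ _ _] := fk; apply: val_inj; rewrite /= fM. Qed.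

Definition corner_functor : functor (Karoubi M) (Karoubi S) :=
  Functor corner_fmap1 corner_fmapM.

Lemma corner_weak_equivalence :
  (forall g : S, is_idem g ->
     exists u v, [/\ g * u = u, u * k = u, u * v = g & v * u = k]) ->
  weak_equivalence corner_functor.
Proof.
have [fM fI ki kk sur] := fk; move=> iso; split=> [d e s t /(congr1 val)|d e u|g].
- by move=> /= /fI; exact: val_inj.
- have [kd dk] := kk (val d); have [ke ek] := kk (val e).
  have [s sE] : exists s, f s = val u.
    apply: sur; split; first by rewrite -(corner_l u) mulgA kd.
    by rewrite -(corner_r u) -mulgA ek.
  have ds : val d * s = s by apply: fI; rewrite fM sE; exact: (corner_l u).
  have se : s * val e = s by apply: fI; rewrite fM sE; exact: (corner_r u).
  by exists (mkCorner ds se : hom d e); apply: val_inj; exact: sE.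
- have [e eE] := sur k (conj ki ki).
  have ei : is_idem e by apply/(corner_embedding_idem fk); rewrite eE.
  exists (mkIdem ei); apply: isomorphic_sym; apply/isomorphic_KaroubiP.
  by have [u [v uv]] := iso (val g) (idemE g); exists u, v; rewrite /= eE.
Qed.

End CornerFunctor.

Section LocalGroup.
Variables (S : semigroupType) (e : S).
Hypotheses (ei : is_idem e)
  (inv : forall x : local_submonoid e, exists y, val (x * y) = e /\ val (y * x) = e).

Definition local_group of is_idem e
  & (forall x : local_submonoid e, exists y, val (x * y) = e /\ val (y * x) = e) :
  Type := local_submonoid e.
Notation G := (local_group ei inv).

HB.instance Definition _ := Choice.on G.

Let one : local_submonoid e := sval (cid (local_lift ei (conj ei ei))).

Let oneE : val one = e. Proof. exact: (svalP (cid (local_lift ei (conj ei ei)))). Qed.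

Let inverse (x : local_submonoid e) : local_submonoid e := sval (cid (inv x)).

Let local_mul (x y : local_submonoid e) : local_submonoid e := x * y.

Let local_mulA : associative local_mul. Proof. exact: mulgA. Qed.

Let local_mul1g : left_id one local_mul.
Proof.
move=> x; apply: val_inj; rewrite -[LHS]/(val one * val x) oneE.
by have [_ _ _ /(_ x)[]] := local_submonoid_embedding ei.
Qed.

Let local_mulg1 : right_id one local_mul.
Proof.
move=> x; apply: val_inj; rewrite -[LHS]/(val x * val one) oneE.
by have [_ _ _ /(_ x)[]] := local_submonoid_embedding ei.
Qed.

Let local_mulVg : left_inverse one inverse local_mul.
Proof. by move=> x; apply: val_inj; rewrite oneE; have [_ ->] := svalP (cid (inv x)). Qed.

Let local_mulgV : right_inverse one inverse local_mul.
Proof. by move=> x; apply: val_inj; rewrite oneE; have [-> _] := svalP (cid (inv x)). Qed.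

HB.instance Definition _ := isGroup.Build G
  local_mulA local_mul1g local_mulg1 local_mulVg local_mulgV.

Definition local_groupType : groupType := G.

Lemma local_group_embedding :
  corner_embedding (val : local_submonoid e -> S) e ->
  corner_embedding (M := local_groupType) (val : local_submonoid e -> S) e.
Proof. by []. Qed.

End LocalGroup.

(** Let [e] be primitive. By simplicity [e = x a y] for every [a] in [e S e], with
    [x] and [y] in [e S e]; then [a y x] and [y x a] are idempotents below [e], so
    they are equal to [e] and [y x] is the inverse of [a]. In the same way, an
    idempotent [g = s e t] is isomorphic to the idempotent [e t g s e], which is
    [e]. *)
Lemma group_of_completely_simple (S : semigroupType) :
  has_local_units S -> completely_simple S ->
  exists G : groupType, morita_equivalent S G.
Proof.
move=> hS [simpleS [e [ei prim]]].
have prim' f : local_idem e f -> f = e.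
  by move=> [[ef fe] fi]; apply: prim.
have factor (a b : S) : exists s t, b = s * a * t.
  have : [set: S]%classic b by [].
  rewrite -(simpleS [set x | exists s t, x = s * a * t]%classic).
    by [].
  split; first by exists (a * a * a), a, a.
  move=> s x [s' [t' ->]]; split; [exists (s * s'), t' | exists s', (t' * s)];
    by rewrite !mulgA.
have em := local_submonoid_embedding ei.
have inv (x : local_submonoid e) : exists y, val (x * y) = e /\ val (y * x) = e.
  have [_ _ _ /(_ x)[ex xe] sur] := em.
  have [s [t est]] := factor (val x) e.
  have [y yE] : exists y : local_submonoid e, val y = e * t * e * s * e.
    by apply: sur; split; word ei.
  exists y; rewrite -[val (x * y)]/(val x * val y) -[val (y * x)]/(val y * val x) yE.
  have exe : e * s * val x * t * e = e.
    transitivity (e * (s * val x * t) * e); first by rewrite !mulgA.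
    by rewrite -est; word ei.
  split; apply: prim'.
    split; first by split; [word ex | word ei].
    by rewrite /is_idem; word (ei, xe, ex, exe).
  split; first by split; [word ei | word xe].
  by rewrite /is_idem; word (ei, xe, ex, exe).
have split_ (g : S) : is_idem g ->
    exists u v, [/\ g * u = u, u * e = u, u * v = g & v * u = e].
  move=> gi; have [s [t gE]] := factor e g.
  have gst : g * s * e * t * g = g.
    transitivity (g * (s * e * t) * g); first by rewrite !mulgA.
    by rewrite -gE; word gi.
  exists (g * s * e), (e * t * g); split; try by word (gi, ei, gst).
  apply: prim'; split; first by split; word ei.
  by rewrite /is_idem; word (gi, ei, gst).
exists (local_groupType ei inv).
have mor : morita_equivalent (local_groupType ei inv) S.
  have hK := corner_weak_equivalence (local_group_embedding ei inv em) split_.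
  apply: morita_of_Karoubi _ hS hK.
  by move=> x; exists 1, 1; rewrite /is_idem !mulg1 mul1g.
have [hG _ /equivalent_categories_sym eq] := mor; by split.
Qed.

(** * Morita equivalence and local properties *)

Lemma regular_locally_of_morita (P : semigroupType -> Prop) (S T : semigroupType) :
  (forall (M : semigroupType) (f : M -> T) k, corner_embedding f k -> P T -> P M) ->
  regular T -> P T -> morita_equivalent S T -> regular S /\ locally_has P S.
Proof.
move=> transfer reg PT mor; have [hS _ _] := mor; have [K hK] := Karoubi_of_morita mor.
split; first exact: regular_of_Karoubi hK reg.
exact: locally_has_of_Karoubi transfer hK PT.
Qed.

Lemma meet_of_morita (S T : semigroupType) :
  union_of_groups T -> morita_equivalent S T ->
  meet_semilattice_under_inclusion (@J_classes S).
Proof.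
move=> ug mor; have [hS _ _] := mor; have [K hK] := Karoubi_of_morita mor.
have regT := union_of_groups_regular ug.
have regS := regular_of_Karoubi hS hK regT.
apply/(meet_semilattice_jmeetP regS)/(jmeet_Karoubi hK regS regT) => x y.
by exists (x * y); exact: union_of_groups_jmeet.
Qed.

Section Converse.
Variable S : semigroupType.
Hypothesis reg : regular S.

Lemma morita_orthodox : locally_has orthodox S ->
  exists2 T, orthodox T & morita_equivalent S T.
Proof.
move=> loc; have [p pF] := factored_sandwich reg.
exists (consolidation p); last exact: morita_consolidation.
split=> [|a b]; first exact: cons_regular.
(* The base idempotent exists as soon as [S] has an element. *)
have [z [q [r zqr]]] := pF (src a).
by have [_] := consolidation_orthodox zqr loc reg; apply.
Qed.

Lemma morita_E_solid : locally_has E_solid S ->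
  exists2 T, E_solid T & morita_equivalent S T.
Proof.
move=> loc; have [p pF] := factored_sandwich reg.
exists (consolidation p); last exact: morita_consolidation.
split=> [|a b c]; first exact: cons_regular.
have [z [q [r zqr]]] := pF (src a).
by have [_] := consolidation_E_solid reg loc zqr; apply.
Qed.

Lemma morita_L_unipotent : locally_has L_unipotent S ->
  exists2 T, L_unipotent T & morita_equivalent S T.
Proof.
move=> loc; have [p pF] := factored_sandwich reg.
exists (local_quotient (consolidation p)); last exact: morita_local_quotient.
split=> [|u]; first exact/local_quotient_regular/cons_regular.
have [a _] := lcls_surj u; have [z [q [r zqr]]] := pF (src a).
by have [_] := local_quotient_L_unipotent zqr loc reg; apply.
Qed.

Lemma morita_inverse : locally_has inverse_semigroup S ->
  exists2 T, inverse_semigroup T & morita_equivalent S T.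
Proof.
move=> loc; have [p pF] := factored_sandwich reg.
exists (local_quotient (consolidation p)); last exact: morita_local_quotient.
have regT := cons_regular (p := p) reg.
apply/inverse_semigroupP; split; first exact: local_quotient_regular.
move=> u; have [a ua] := lcls_surj u; have [z [q [r zqr]]] := pF (src a).
move: u {a ua}.
have [_ idM] := consolidation_orthodox zqr (locally_has_mono inverse_orthodox loc) reg.
apply: local_quotient_idem_comm => // e x y; apply: consolidation_locally_comm.
by move=> {}e {}x {}y ei xl yl; exact: locally_inverse_comm ei _ _ loc xl yl.
Qed.

Lemma morita_union_of_groups : locally_has union_of_groups S ->
  meet_semilattice_under_inclusion (@J_classes S) ->
  exists2 T, union_of_groups T & morita_equivalent S T.
Proof.
move=> loc /(meet_semilattice_jmeetP reg)/(meet_sandwich reg)[p pmeet].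
exists (consolidation p); last exact: morita_consolidation.
exact: consolidation_union_of_groups.
Qed.

(** The consolidation is a band, because for [x] in [e S f] the element [x p] is
    idempotent and [x] is in [x p S]. *)
Lemma morita_semilattice : locally_has semilattice S ->
  meet_semilattice_under_inclusion (@J_classes S) ->
  exists2 T, semilattice T & morita_equivalent S T.
Proof.
move=> loc /(meet_semilattice_jmeetP reg)/(meet_sandwich reg)[p pmeet].
have locu := locally_has_mono semilattice_union_of_groups loc.
exists (local_quotient (consolidation p)); last exact: morita_local_quotient.
have band (a : consolidation p) : is_idem a.
  apply/cons_idemP; have [ei fi] := (src_idem a, tgt_idem a).
  have [ex xf] : between (src a) (tgt a) (elt a).
    by split; [exact: elt_src | exact: elt_tgt].
  have [fq qe] := sw_between p fi ei.
  have [m xqm] := divides_r reg locu fi (conj ex xf) (conj fq qe)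
    (between_jle pmeet ei fi (conj ex xf)).
  have xqb : between (src a) (src a) (elt a * p (tgt a) (src a)).
    by split; [rewrite mulgA ex | rewrite -mulgA qe].
  have [] := locally_semilattice_elt ei loc xqb xqb; rewrite /is_idem !mulgA => xq _.
  by rewrite -{2}xqm; word (xqm, xq).
have bandQ (u : local_quotient (consolidation p)) : is_idem u.
  by have [a ->] := lcls_surj u; rewrite /is_idem -lclsM band.
split=> // u v; apply: local_quotient_idem_comm => //; last exact: cons_regular.
move=> e x y; apply: consolidation_locally_comm => {}e {}x {}y ei [xb _] [yb _].
by have [] := locally_semilattice_elt ei loc xb yb.
Qed.

End Converse.

Theorem theorem5p5 (S : semigroupType) (hS : has_local_units S) :
  ((exists G : groupType, morita_equivalent S G) <-> completely_simple S)
  /\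
  ((exists2 T : semigroupType, inverse_semigroup T & morita_equivalent S T) <->
     regular S /\ locally_has inverse_semigroup S)
  /\
  ((exists2 T : semigroupType, semilattice T & morita_equivalent S T) <->
     [/\ regular S, locally_has semilattice S
       & meet_semilattice_under_inclusion (@J_classes S)])
  /\
  ((exists2 T : semigroupType, orthodox T & morita_equivalent S T) <->
     regular S /\ locally_has orthodox S)
  /\
  ((exists2 T : semigroupType, L_unipotent T & morita_equivalent S T) <->
     regular S /\ locally_has L_unipotent S)
  /\
  ((exists2 T : semigroupType, E_solid T & morita_equivalent S T) <->
     regular S /\ locally_has E_solid S)
  /\
  ((exists2 T : semigroupType, union_of_groups T & morita_equivalent S T) <->
     [/\ regular S, locally_has union_of_groups S
       & meet_semilattice_under_inclusion (@J_classes S)]).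
Proof.
split.
  split=> [[G mor]|cs]; first exact: completely_simple_of_group mor.
  exact: group_of_completely_simple.
split.
  split=> [[T inv mor]|[reg loc]]; last exact: morita_inverse.
  have /inverse_semigroupP[regT _] := inv.
  exact: regular_locally_of_morita (fun M => @corner_inverse_semigroup M T) regT inv mor.
split.
  split=> [[T sl mor]|[reg loc meet]]; last exact: morita_semilattice.
  have ug := semilattice_union_of_groups sl.
  have [reg loc] := regular_locally_of_morita (fun M => @corner_semilattice M T)
    (union_of_groups_regular ug) sl mor.
  by split=> //; exact: meet_of_morita ug mor.
split.
  split=> [[T ort mor]|[reg loc]]; last exact: morita_orthodox.
  exact: regular_locally_of_morita (fun M => @corner_orthodox M T) (proj1 ort) ort mor.
split.
  split=> [[T lu mor]|[reg loc]]; last exact: morita_L_unipotent.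
  exact: regular_locally_of_morita (fun M => @corner_L_unipotent M T) (proj1 lu) lu mor.
split.
  split=> [[T es mor]|[reg loc]]; last exact: morita_E_solid.
  exact: regular_locally_of_morita (fun M => @corner_E_solid M T) (proj1 es) es mor.
split=> [[T ug mor]|[reg loc meet]]; last exact: morita_union_of_groups.
have [reg loc] := regular_locally_of_morita (fun M => @corner_union_of_groups M T)
  (union_of_groups_regular ug) ug mor.
by split=> //; exact: meet_of_morita ug mor.
Qed.
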